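(* Define $\kappa_2(t)$ for integers $t\ge1$ by $\kappa_2(1)=2$, $\kappa_2(2t)=\kappa_2(t)$, and $\kappa_2(2t+1)=\frac{\kappa_2(t)+\kappa_2(t+1)}{2}+1$. There exist constants $M_0$ and $C$ such that for every positive integer $t$ whose binary expansion has $M>M_0$ maximal blocks of $1$s, and for all integers $j$, \[\left|\delta(j,t)-\frac{1}{\sqrt{2\pi\kappa_2(t)}}\exp\left(-\frac{j^2}{2\kappa_2(t)}\right)\right|\le C\,M^{-1}(\log M)^4.\]
   Context: $s(n)$ denotes the number of $1$s in the binary expansion of the nonnegative integer $n$. For integers $j$ and $t\ge0$, $\delta(j,t)=\lim_{N\to\infty}\frac1N\bigl|\{0\le n<N: s(n+t)-s(n)=j\}\bigr|$ (this limit exists). A maximal block of $1$s in the binary expansion of $t$ is a maximal run of consecutive binary digits equal to $1$. *)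

(* Defs.v *)
From Stdlib Require Import Reals ZArith Arith List Lia.
From Coquelicot Require Import Coquelicot.
Import ListNotations.
Open Scope R_scope.

Definition s (n : nat) : nat :=
  length (filter (fun i => Nat.testbit n i) (seq 0 (S (Nat.log2 n)))).

Definition count_delta (j : Z) (t N : nat) : nat :=
  length (filter
    (fun n => Z.eqb (Z.of_nat (s (n + t)) - Z.of_nat (s n))%Z j) (seq 0 N)).

(* delta(j,t) = lim_{N -> oo} (1/N) |{0 <= n < N : s(n+t)-s(n) = j}|
   (the limit exists; real (Lim_seq _) is its value). *)
Definition delta (j : Z) (t : nat) : R :=
  real (Lim_seq (fun N => INR (count_delta j t N) / INR N)).

(* kappa_2 via the recursion kappa(1)=2, kappa(2t)=kappa(t),
   kappa(2t+1) = (kappa(t)+kappa(t+1))/2 + 1, computed with fuel.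
   For t >= 2 the recursive arguments t/2 and t/2+1 are < t, so fuel t
   suffices for every t >= 1. *)
Fixpoint kappa2_fuel (fuel t : nat) : R :=
  match fuel with
  | O => 0
  | S f =>
      if Nat.leb t 1 then 2
      else if Nat.even t then kappa2_fuel f (Nat.div2 t)
      else (kappa2_fuel f (Nat.div2 t) + kappa2_fuel f (S (Nat.div2 t))) / 2 + 1
  end.

Definition kappa2 (t : nat) : R := kappa2_fuel t t.

(* Number of maximal blocks of 1s in the binary expansion of t:
   each maximal block ends at exactly one position i with bit i = 1
   and bit (i+1) = 0. *)
Definition blocks (t : nat) : nat :=
  length (filter (fun i => andb (Nat.testbit t i) (negb (Nat.testbit t (S i))))
                 (seq 0 (S (Nat.log2 t)))).

(* Main.v *)
(** With gamma_t(x) = sum_j delta(j,t) e^{ijx}, the digit recursion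
    delta(j,2t) = delta(j,t), delta(j,2t+1) = (delta(j-1,t) + delta(j+1,t+1)) / 2
    becomes gamma_{2t} = gamma_t and
    gamma_{2t+1} = (e^{ix} gamma_t + e^{-ix} gamma_{t+1}) / 2.
    The Gaussian exp(-kappa2(t) x^2 / 2) satisfies the same recursion up to an
    error 2|x|^3, and since kappa2 itself obeys this averaging recursion with
    increment 1, the two functions differ by at most 2 |x|^3 kappa2(t).
    On the other hand every maximal block of ones yields cancellation between
    the two terms of the average, whence |gamma_t(x)| <= exp(-c M x^2).
    Fourier inversion over |x| <= T = 21 log M / sqrt M gives an error of order
    kappa2(t) T^4, i.e. M^{-1} (log M)^4 because M <= kappa2(t) <= 4 M; the rest
    of [-pi, pi] contributes O(1/M). *)

Require Import Defs.
From Stdlib Require Import Reals ZArith Arith List Lia Lra.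
From Coquelicot Require Import Coquelicot.
Open Scope R_scope.

(** * Digit recursions *)

(** The recursions at 2t and 2t+1 involve only t and t+1, so most inductions carry a statement about
    the pair (t, t+1), which reproduces itself under both digits. Starting from t = 0 leaves one
    self-reference, at t = 1, where the equation for gamma_1 is solved in closed form. The error is
    cubic for this reason: averaging two Gaussians whose variances differ by at most 2 is correct to
    second order, and the first mismatch is the imaginary part, sin x times the difference of the
    Gaussians. A single averaging step need not shrink the modulus, since its two terms may align.
    In two consecutive odd steps one value enters twice, with phases x apart, and this forces a
    loss. No series over j is summed: counts up to N are compared with N times a Fourier
    coefficient, with error O(t sqrt N), which yields the limit and its value together. *)

Lemma binary_pair_ind (P : nat -> Prop) :
  P 0%nat ->
  (forall t, P t -> P (2 * t)%nat) ->
  (forall t, P t -> P (2 * t + 1)%nat) ->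
  forall t, P t.
Proof.
  intros H0 He Ho t; induction t as [t IH] using lt_wf_ind.
  destruct (Nat.Even_or_Odd t) as [[m ->]|[m ->]].
  - destruct (Nat.eq_dec m 0) as [->|Hm]; [exact H0|].
    apply He, IH; lia.
  - apply Ho, IH; lia.
Qed.

(** The ranges in [s] and [blocks] depend on [Nat.log2 n]; padding them with zero digits lets n, 2n
    and 2n+1 be compared over a common range. *)
Lemma filter_seq_bits_ext (f : nat -> bool) (a b : nat) :
  (a <= b)%nat -> (forall i, (a <= i)%nat -> f i = false) ->
  length (filter f (seq 0 b)) = length (filter f (seq 0 a)).
Proof.
  intros Hab Hf.
  replace b with (a + (b - a))%nat by lia.
  rewrite seq_app, filter_app, length_app; simpl.
  replace (filter f (seq a (b - a))) with (@nil nat); [simpl; lia|].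
  symmetry; generalize (b - a)%nat as k; intros k.
  assert (G : forall c, (a <= c)%nat -> filter f (seq c k) = nil).
  { induction k as [|k IH]; intros c Hc; simpl; [reflexivity|].
    rewrite Hf by exact Hc. apply IH; lia. }
  apply G; lia.
Qed.

Lemma filter_seq_succ (f : nat -> bool) (k : nat) :
  length (filter f (seq 0 (S k)))
  = ((if f 0%nat then 1 else 0)
     + length (filter (fun i => f (S i)) (seq 0 k)))%nat.
Proof.
  simpl; rewrite <- seq_shift, filter_map_swap.
  destruct (f 0%nat); simpl; rewrite length_map; reflexivity.
Qed.

Lemma testbit_above_log2 (n i : nat) :
  (S (Nat.log2 n) <= i)%nat -> Nat.testbit n i = false.
Proof.
  intros Hi; apply Nat.bits_above_log2; lia.
Qed.

Lemma s_eq (n k : nat) : (S (Nat.log2 n) <= k)%nat ->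
  length (filter (fun i => Nat.testbit n i) (seq 0 k)) = s n.
Proof.
  intros Hk; apply filter_seq_bits_ext; [exact Hk|].
  intros i Hi; apply testbit_above_log2, Hi.
Qed.

Lemma blocks_eq (n k : nat) : (S (Nat.log2 n) <= k)%nat ->
  length (filter (fun i => andb (Nat.testbit n i) (negb (Nat.testbit n (S i))))
                 (seq 0 k)) = blocks n.
Proof.
  intros Hk; apply filter_seq_bits_ext; [exact Hk|].
  intros i Hi; rewrite testbit_above_log2 by exact Hi; reflexivity.
Qed.

Lemma s_double (n : nat) : s (2 * n) = s n.
Proof.
  set (k := (S (Nat.log2 n) + S (Nat.log2 (2 * n)))%nat).
  rewrite <- (s_eq (2 * n) (S k)), <- (s_eq n k) by (unfold k; lia).
  rewrite filter_seq_succ, Nat.testbit_even_0, Nat.add_0_l.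
  f_equal; apply filter_ext; intros i; apply Nat.double_bits_succ.
Qed.

Lemma s_double_succ (n : nat) : s (2 * n + 1) = S (s n).
Proof.
  set (k := (S (Nat.log2 n) + S (Nat.log2 (2 * n + 1)))%nat).
  rewrite <- (s_eq (2 * n + 1) (S k)), <- (s_eq n k) by (unfold k; lia).
  rewrite filter_seq_succ, Nat.testbit_odd_0, Nat.add_1_l.
  f_equal.
  f_equal; apply filter_ext; intros i; apply Nat.testbit_odd_succ'.
Qed.

Lemma blocks_double (n : nat) : blocks (2 * n) = blocks n.
Proof.
  set (k := (S (Nat.log2 n) + S (Nat.log2 (2 * n)))%nat).
  rewrite <- (blocks_eq (2 * n) (S k)), <- (blocks_eq n k) by (unfold k; lia).
  rewrite filter_seq_succ, Nat.testbit_even_0.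
  cbn [andb]; rewrite Nat.add_0_l.
  f_equal; apply filter_ext; intros i.
  rewrite !Nat.double_bits_succ; reflexivity.
Qed.

(** An appended 1 opens a new block when the last digit of n is 0, and otherwise prolongs the last
    block. *)
Lemma blocks_double_succ (n : nat) :
  blocks (2 * n + 1) = (blocks n + (if Nat.even n then 1 else 0))%nat.
Proof.
  set (k := (S (Nat.log2 n) + S (Nat.log2 (2 * n + 1)))%nat).
  rewrite <- (blocks_eq (2 * n + 1) (S k)), <- (blocks_eq n k)
    by (unfold k; lia).
  rewrite filter_seq_succ, Nat.testbit_odd_0, Nat.testbit_odd_succ', Nat.bit0_odd.
  rewrite <- Nat.negb_even, Bool.negb_involutive, Nat.add_comm; cbn [andb].
  f_equal; f_equal; apply filter_ext; intros i.
  rewrite !Nat.testbit_odd_succ'; reflexivity.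
Qed.

(** At t = 0 this fails: the value is 0 with no fuel and 2 with positive fuel. *)
Lemma kappa2_fuel_indep (f g t : nat) : (1 <= t)%nat ->
  (t <= f)%nat -> (t <= g)%nat -> kappa2_fuel f t = kappa2_fuel g t.
Proof.
  revert g t; induction f as [|f IH]; intros g t Ht Hf Hg; [lia|].
  destruct g as [|g]; [lia|]; simpl.
  destruct (Nat.leb_spec t 1) as [H1|H1]; [reflexivity|].
  destruct (Nat.even t) eqn:E.
  - apply Nat.even_spec in E as [m ->].
    rewrite Nat.div2_double; apply IH; lia.
  - assert (O : Nat.Odd t).
    { apply Nat.odd_spec; rewrite <- Nat.negb_even, E; reflexivity. }
    destruct O as [m ->].
    replace (2 * m + 1)%nat with (S (2 * m)) by lia.
    rewrite Nat.div2_succ_double.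
    rewrite (IH g m), (IH g (S m)) by lia; reflexivity.
Qed.

(* With the junk value [kappa2 0 = 0] the recursion also holds for [t = 0],
   so inductions can start there. *)
Lemma kappa2_0 : kappa2 0 = 0.
Proof. reflexivity. Qed.

Lemma kappa2_double (t : nat) : kappa2 (2 * t) = kappa2 t.
Proof.
  destruct (Nat.eq_dec t 0) as [->|Ht]; [reflexivity|].
  unfold kappa2 at 1.
  rewrite (kappa2_fuel_indep (2 * t) (S (2 * t)) (2 * t)) by lia.
  cbn [kappa2_fuel].
  destruct (Nat.leb_spec (2 * t) 1) as [H1|_]; [lia|].
  rewrite Nat.even_even, Nat.div2_double.
  apply kappa2_fuel_indep; lia.
Qed.

Lemma kappa2_double_succ (t : nat) :
  kappa2 (2 * t + 1) = (kappa2 t + kappa2 (t + 1)) / 2 + 1.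
Proof.
  destruct (Nat.eq_dec t 0) as [->|Ht].
  - unfold kappa2; simpl; lra.
  - unfold kappa2 at 1.
    replace (2 * t + 1)%nat with (S (2 * t)) by lia.
    cbn [kappa2_fuel].
    destruct (Nat.leb_spec (S (2 * t)) 1) as [H1|_]; [lia|].
    rewrite Nat.even_succ, Nat.odd_even, Nat.div2_succ_double.
    replace (t + 1)%nat with (S t) by lia.
    unfold kappa2.
    rewrite (kappa2_fuel_indep (2 * t) t t) by lia.
    rewrite (kappa2_fuel_indep (2 * t) (S t) (S t)) by lia.
    reflexivity.
Qed.

Lemma double_succ_succ (t : nat) : (2 * t + 1 + 1)%nat = (2 * (t + 1))%nat.
Proof. lia. Qed.

(** If d is the difference at t, the differences at 2t and 2t+1 are d/2 + 1 and d/2 - 1, and [-2, 2]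
    is stable under both maps. *)
Lemma kappa2_step (t : nat) : Rabs (kappa2 (t + 1) - kappa2 t) <= 2.
Proof.
  induction t as [|t IH|t IH] using binary_pair_ind.
  - unfold kappa2; simpl; apply Rabs_le; lra.
  - rewrite kappa2_double, kappa2_double_succ.
    apply Rabs_le_between in IH; apply Rabs_le; lra.
  - rewrite double_succ_succ, kappa2_double, kappa2_double_succ.
    apply Rabs_le_between in IH; apply Rabs_le; lra.
Qed.

Lemma even_double_false (t : nat) : Nat.even (2 * t + 1) = false.
Proof. rewrite Nat.add_1_r, Nat.even_succ; apply Nat.odd_even. Qed.

(** The odd range for [kappa2 (t + 1)] is the even one with b - 1 in place of b: a trailing block of
    ones is not yet counted. This parity shift is what lets the bounds pass through the average in
    [kappa2_double_succ]. *)
Lemma blocks_kappa2_pair (t : nat) :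
  let b := INR (blocks t) in
  b <= kappa2 t <= 4 * b /\
  if Nat.even t then b + 1 <= kappa2 (t + 1) <= 4 * b + 2
  else b <= kappa2 (t + 1) <= 4 * b - 2.
Proof.
  induction t as [|t IH|t IH] using binary_pair_ind.
  - cbn; lra.
  - cbv zeta in *.
    rewrite Nat.even_even, blocks_double, kappa2_double, kappa2_double_succ.
    destruct (Nat.even t); lra.
  - cbv zeta in *.
    rewrite even_double_false, blocks_double_succ, double_succ_succ, kappa2_double,
      kappa2_double_succ, plus_INR.
    destruct (Nat.even t); cbn [INR]; lra.
Qed.

Lemma blocks_le_kappa2 (t : nat) : INR (blocks t) <= kappa2 t.
Proof. apply blocks_kappa2_pair. Qed.

Lemma kappa2_le_blocks (t : nat) : kappa2 t <= 4 * INR (blocks t).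
Proof. apply blocks_kappa2_pair. Qed.

Lemma kappa2_nonneg (t : nat) : 0 <= kappa2 t.
Proof.
  apply Rle_trans with (2 := blocks_le_kappa2 t), pos_INR.
Qed.

Lemma count_delta_succ (j : Z) (t n : nat) :
  count_delta j t (S n)
  = (count_delta j t n
     + (if Z.eqb (Z.of_nat (s (n + t)) - Z.of_nat (s n)) j then 1 else 0))%nat.
Proof.
  unfold count_delta; rewrite seq_S, filter_app, length_app, Nat.add_0_l.
  simpl; destruct Z.eqb; reflexivity.
Qed.

Lemma count_delta_0 (j : Z) (n : nat) :
  count_delta j 0 n = (if Z.eqb j 0 then n else 0)%nat.
Proof.
  induction n as [|n IH].
  - destruct Z.eqb; reflexivity.
  - rewrite count_delta_succ, IH, Nat.add_0_r, Z.sub_diag.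
    destruct (Z.eqb_spec j 0), (Z.eqb_spec 0 j); lia.
Qed.

Lemma count_delta_double (j : Z) (t n : nat) :
  count_delta j (2 * t) (2 * n) = (2 * count_delta j t n)%nat.
Proof.
  induction n as [|n IH]; [reflexivity|].
  replace (2 * S n)%nat with (S (S (2 * n))) by lia.
  rewrite !count_delta_succ, IH.
  replace (2 * n + 2 * t)%nat with (2 * (n + t))%nat by lia.
  replace (S (2 * n) + 2 * t)%nat with (2 * (n + t) + 1)%nat by lia.
  replace (S (2 * n))%nat with (2 * n + 1)%nat by lia.
  rewrite !s_double, !s_double_succ.
  replace (Z.of_nat (S (s (n + t))) - Z.of_nat (S (s n)))%Z
    with (Z.of_nat (s (n + t)) - Z.of_nat (s n))%Z by lia.
  destruct Z.eqb; lia.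
Qed.

(** Split by the parity of the counted integer: 2m gains a digit 1 in the sum, while 2m+1 loses its
    last 1 and carries into t+1. *)
Lemma count_delta_double_succ (j : Z) (t n : nat) :
  count_delta j (2 * t + 1) (2 * n)
  = (count_delta (j - 1) t n + count_delta (j + 1) (t + 1) n)%nat.
Proof.
  induction n as [|n IH]; [reflexivity|].
  replace (2 * S n)%nat with (S (S (2 * n))) by lia.
  rewrite !count_delta_succ, IH.
  replace (2 * n + (2 * t + 1))%nat with (2 * (n + t) + 1)%nat by lia.
  replace (S (2 * n) + (2 * t + 1))%nat with (2 * (n + (t + 1)))%nat by lia.
  replace (S (2 * n))%nat with (2 * n + 1)%nat by lia.
  rewrite !s_double, !s_double_succ.
  generalize (s (n + (t + 1))) (s (n + t)) (s n); intros a b c.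
  destruct (Z.eqb_spec (Z.of_nat (S b) - Z.of_nat c) j),
    (Z.eqb_spec (Z.of_nat a - Z.of_nat (S c)) j),
    (Z.eqb_spec (Z.of_nat b - Z.of_nat c) (j - 1)),
    (Z.eqb_spec (Z.of_nat a - Z.of_nat c) (j + 1)); lia.
Qed.

(** * The characteristic function *)

Definition cis (x : R) : C := (cos x, sin x).

Lemma Cmod_cis (x : R) : Cmod (cis x) = 1.
Proof.
  unfold Cmod, cis; simpl fst; simpl snd.
  rewrite <- sqrt_1; f_equal.
  rewrite <- (sin2_cos2 x); unfold Rsqr; ring.
Qed.

Lemma cis_neg (x : R) : (cis x * cis (- x) = 1)%C.
Proof.
  unfold cis; rewrite cos_neg, sin_neg.
  apply injective_projections; simpl; [|ring].
  pose proof (sin2_cos2 x) as H; unfold Rsqr in H; lra.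
Qed.

Definition twist (x : R) (u v : C) : C :=
  (RtoC (/ 2) * (cis x * u + cis (- x) * v))%C.

Lemma Cmod_half : Cmod (RtoC (/ 2)) = / 2.
Proof. rewrite Cmod_R; apply Rabs_pos_eq; lra. Qed.

Lemma Cmod_twist (x : R) (u v : C) :
  Cmod (twist x u v) <= (Cmod u + Cmod v) / 2.
Proof.
  unfold twist; rewrite Cmod_mult, Cmod_half.
  pose proof (Cmod_triangle (cis x * u) (cis (- x) * v)) as H.
  rewrite !Cmod_mult, !Cmod_cis in H; lra.
Qed.

Lemma Cmod_twist_le (x p : R) (u v : C) :
  Cmod u <= p -> Cmod v <= p -> Cmod (twist x u v) <= p.
Proof. pose proof (Cmod_twist x u v); lra. Qed.

(** This is e^{ix} / (2 - e^{-ix}) in real coordinates, the solution of g = (e^{ix} + e^{-ix} g) /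
    2; the denominator is |2 - e^{-ix}|^2. *)
Definition gamma1 (x : R) : C :=
  ((2 * cos x - (cos x * cos x - sin x * sin x)) / (5 - 4 * cos x),
   (2 * sin x - 2 * sin x * cos x) / (5 - 4 * cos x)).

Lemma gamma1_denominator_pos (x : R) : 0 < 5 - 4 * cos x.
Proof. pose proof (COS_bound x); lra. Qed.

Lemma gamma1_twist (x : R) : gamma1 x = twist x 1 (gamma1 x).
Proof.
  pose proof (gamma1_denominator_pos x) as Hd.
  pose proof (sin2_cos2 x) as H; unfold Rsqr in H.
  unfold twist, gamma1, cis; rewrite cos_neg, sin_neg.
  set (c := cos x) in *; set (z := sin x) in *.
  apply injective_projections; simpl;
    apply Rmult_eq_reg_r with (5 - 4 * c); try lra; field_simplify; try lra;
    replace (z ^ 2) with (1 - c ^ 2) by lra;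
    replace (z ^ 3) with (z * (1 - c ^ 2))
      by (replace (1 - c ^ 2) with (z * z) by lra; ring); field; lra.
Qed.

(* The pair [(gamma_p, gamma_(p+1))], obtained from the recursion alone; that
   its Fourier coefficients are the densities is [delta_fourier]. *)
Fixpoint gamma_pair (x : R) (p : positive) : C * C :=
  match p with
  | xH => (gamma1 x, gamma1 x)
  | xO q => let (u, v) := gamma_pair x q in (u, twist x u v)
  | xI q => let (u, v) := gamma_pair x q in (twist x u v, v)
  end.

(** The value 1 at t = 0 is the transform of the point mass delta(., 0), so the digit recursion also
    holds there. *)
Definition gamma (t : nat) (x : R) : C :=
  match t with
  | O => 1
  | S _ => fst (gamma_pair x (Pos.of_nat t))
  end.

Lemma gamma_pair_snd (x : R) (p : positive) :
  snd (gamma_pair x p) = fst (gamma_pair x (Pos.succ p)).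
Proof.
  induction p as [p IH|p IH|]; simpl; [| |reflexivity];
    destruct (gamma_pair x p) as [u v]; [|reflexivity].
  simpl in *; rewrite IH; destruct (gamma_pair x (Pos.succ p)); reflexivity.
Qed.

Lemma gamma_pos (t : nat) (x : R) : (1 <= t)%nat ->
  gamma t x = fst (gamma_pair x (Pos.of_nat t)).
Proof. destruct t; [lia|reflexivity]. Qed.

Lemma gamma_0 (x : R) : gamma 0 x = 1.
Proof. reflexivity. Qed.

Lemma gamma_double (t : nat) (x : R) : gamma (2 * t) x = gamma t x.
Proof.
  destruct (Nat.eq_dec t 0) as [->|Ht]; [reflexivity|].
  rewrite !gamma_pos by lia.
  replace (Pos.of_nat (2 * t)) with (xO (Pos.of_nat t)) by lia.
  simpl; destruct (gamma_pair x (Pos.of_nat t)); reflexivity.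
Qed.

Lemma gamma_double_succ (t : nat) (x : R) :
  gamma (2 * t + 1) x = twist x (gamma t x) (gamma (t + 1) x).
Proof.
  destruct (Nat.eq_dec t 0) as [->|Ht]; [exact (gamma1_twist x)|].
  rewrite !gamma_pos by lia.
  replace (Pos.of_nat (2 * t + 1)) with (xI (Pos.of_nat t)) by lia.
  replace (Pos.of_nat (t + 1)) with (Pos.succ (Pos.of_nat t)) by lia.
  rewrite <- gamma_pair_snd; simpl.
  destruct (gamma_pair x (Pos.of_nat t)); reflexivity.
Qed.

Lemma gamma_double_succ_succ (t : nat) (x : R) :
  gamma (2 * t + 1 + 1) x = gamma (t + 1) x.
Proof. rewrite double_succ_succ; apply gamma_double. Qed.

Lemma Cmod_gamma_le_1_pair (x : R) (t : nat) :
  Cmod (gamma t x) <= 1 /\ Cmod (gamma (t + 1) x) <= 1.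
Proof.
  induction t as [|t IH|t IH] using binary_pair_ind.
  - rewrite gamma_0, Cmod_1; split; [lra|].
    pose proof (Cmod_twist x 1 (gamma1 x)) as H.
    rewrite <- gamma1_twist, Cmod_1 in H.
    change (gamma (0 + 1) x) with (gamma1 x); lra.
  - rewrite gamma_double, gamma_double_succ.
    split; [|apply Cmod_twist_le]; apply IH.
  - rewrite gamma_double_succ, gamma_double_succ_succ.
    split; [apply Cmod_twist_le|]; apply IH.
Qed.

Lemma Cmod_gamma_le_1 (x : R) (t : nat) : Cmod (gamma t x) <= 1.
Proof. apply Cmod_gamma_le_1_pair. Qed.

(** The squares of the two sides differ by exactly (1 - c)^2 / 36. *)
Lemma Cmod_contraction (c z : R) : c * c + z * z = 1 ->
  Cmod (c / 2 + / 4, z / 2) <= 3 / 4 - (1 - c) / 6.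
Proof.
  intros H; unfold Cmod; simpl fst; simpl snd.
  assert (Hc : -1 <= c <= 1) by (split; nra).
  rewrite <- (sqrt_Rsqr (3 / 4 - (1 - c) / 6)) by lra.
  apply sqrt_le_1_alt; unfold Rsqr; nra.
Qed.

(** In the expansion u has weight 1/2 with phase e^{ix} and weight 1/4 with phase 1, because e^{ix}
    e^{-ix} = 1. These partly cancel, while v keeps modulus 1/4. *)
Lemma Cmod_twist_twist_l (x p : R) (u v : C) :
  Cmod u <= p -> Cmod v <= p ->
  Cmod (twist x u (twist x u v)) <= (1 - (1 - cos x) / 6) * p.
Proof.
  intros Hu Hv.
  replace (twist x u (twist x u v))
    with (((cos x / 2 + / 4, sin x / 2)%R : C) * u
          + RtoC (/ 4) * (cis (- x) * cis (- x) * v))%C.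
  2: { unfold twist.
       replace (cos x / 2 + / 4, sin x / 2)
         with (RtoC (/ 2) * cis x + RtoC (/ 4) * (cis x * cis (- x)))%C.
       - replace (RtoC (/ 4)) with (RtoC (/ 2) * RtoC (/ 2))%C
           by (rewrite <- RtoC_mult; f_equal; lra).
         ring.
       - rewrite cis_neg; unfold cis.
         apply injective_projections; simpl; lra. }
  eapply Rle_trans; [apply Cmod_triangle|].
  rewrite !Cmod_mult, !Cmod_cis, Cmod_R, (Rabs_pos_eq (/ 4)) by lra.
  pose proof (Cmod_contraction (cos x) (sin x)) as H.
  pose proof (sin2_cos2 x) as H2; unfold Rsqr in H2.
  specialize (H ltac:(lra)).
  pose proof (Cmod_ge_0 (cos x / 2 + / 4, sin x / 2)).
  pose proof (Cmod_ge_0 u).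
  nra.
Qed.

Lemma Cmod_twist_twist_r (x p : R) (u v : C) :
  Cmod u <= p -> Cmod v <= p ->
  Cmod (twist x (twist x u v) v) <= (1 - (1 - cos x) / 6) * p.
Proof.
  intros Hu Hv.
  replace (twist x (twist x u v) v)
    with (twist (- x) v (twist (- x) v u)).
  - rewrite <- (cos_neg x); apply Cmod_twist_twist_l; assumption.
  - unfold twist; rewrite Ropp_involutive; ring.
Qed.

(** Write 1 - cos y = 2 sin(y/2)^2. The bound sin u >= u - u^3/6 gives sin u >= u/3 for 0 <= u <= 2,
    which covers u = y/2 because PI <= 4. *)
Lemma one_minus_cos_ge (x : R) : - PI <= x <= PI -> x ^ 2 / 18 <= 1 - cos x.
Proof.
  assert (H : forall y, 0 <= y <= PI -> y ^ 2 / 18 <= 1 - cos y).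
  { intros y Hy.
    pose proof PI_4.
    pose proof (pre_sin_bound (y / 2) 0 ltac:(lra) ltac:(lra)) as [Hs _].
    unfold sin_approx, sin_term in Hs; simpl in Hs.
    assert (Hs' : y / 6 <= sin (y / 2)) by nra.
    replace y with (2 * (y / 2)) at 2 by field.
    rewrite cos_2a_sin; nra. }
  intros Hx; destruct (Rle_dec 0 x) as [H0|H0].
  - apply H; lra.
  - rewrite <- cos_neg.
    replace (x ^ 2) with ((- x) ^ 2) by ring.
    apply H; lra.
Qed.

Lemma pow_le_of_le_1 (r : R) (m n : nat) :
  0 <= r <= 1 -> (m <= n)%nat -> r ^ n <= r ^ m.
Proof.
  intros Hr Hmn; replace n with (m + (n - m))%nat by lia.
  rewrite pow_add.
  pose proof (pow_le r m (proj1 Hr)).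
  assert (r ^ (n - m) <= 1) by (rewrite <- (pow1 (n - m)); apply pow_incr, Hr).
  nra.
Qed.

(* An odd index loses a factor relative to the pair two binary digits up;
   both members of a pair are affected only at a digit string 10, and the
   exponent is off by one while the last block of ones is still open. *)
Lemma Cmod_gamma_pair_le (x r : R) (t : nat) :
  0 <= r <= 1 -> 1 - (1 - cos x) / 6 <= r ^ 2 ->
  let e := if Nat.even t then blocks t else pred (blocks t) in
  Cmod (gamma t x) <= r ^ e /\ Cmod (gamma (t + 1) x) <= r ^ e.
Proof.
  intros Hr Hrho.
  (* One contraction is worth two factors r: one pays for a new block, the other makes up for the
     [pred] of a block still open. *)
  assert (Hgain : forall (w : C) (k m : nat),
    Cmod w <= (1 - (1 - cos x) / 6) * r ^ m -> (k <= 2 + m)%nat ->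
    Cmod w <= r ^ k).
  { intros w k m Hw Hkm.
    apply Rle_trans with (r ^ (2 + m)); [|apply pow_le_of_le_1; assumption].
    apply Rle_trans with (1 := Hw); rewrite pow_add.
    apply Rmult_le_compat_r; [apply pow_le, Hr|exact Hrho]. }
  (* Strong induction, since the case of a final 10 looks back two digits for gamma_{t+1} and three
     for gamma_t. *)
  induction t as [t IH] using lt_wf_ind; cbv zeta in *.
  assert (IHw : forall m, (m < t)%nat ->
    Cmod (gamma m x) <= r ^ pred (blocks m)
    /\ Cmod (gamma (m + 1) x) <= r ^ pred (blocks m)).
  { intros m Hm; destruct (IH m Hm) as [H1 H2].
    destruct (Nat.even m); [|split; assumption].
    pose proof (pow_le_of_le_1 r (pred (blocks m)) (blocks m) Hr ltac:(lia)).
    split; lra. }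
  destruct (Nat.Even_or_Odd t) as [[m ->]|[m ->]].
  - destruct (Nat.eq_dec m 0) as [->|Hm].
    { change (blocks (2 * 0)) with 0%nat; simpl Nat.even; cbv iota; simpl pow.
      split; apply Cmod_gamma_le_1. }
    rewrite Nat.even_even, blocks_double, gamma_double, gamma_double_succ.
    destruct (Nat.Even_or_Odd m) as [[k ->]|[k ->]].
    + specialize (IH (2 * k)%nat ltac:(lia)); rewrite Nat.even_even in IH.
      split; [|apply Cmod_twist_le]; apply IH.
    + destruct (IHw k ltac:(lia)) as [Hk1 Hk2].
      split.
      * destruct (Nat.Even_or_Odd k) as [[l ->]|[l ->]];
          destruct (IHw l ltac:(lia)) as [Hl1 Hl2].
        -- rewrite gamma_double_succ, gamma_double, gamma_double_succ.
           apply Hgain with (pred (blocks l)).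
           ++ apply Cmod_twist_twist_l; assumption.
           ++ rewrite blocks_double_succ, blocks_double.
              destruct (Nat.even _); lia.
        -- rewrite gamma_double_succ, gamma_double_succ,
             gamma_double_succ_succ.
           apply Hgain with (pred (blocks l)).
           ++ apply Cmod_twist_twist_r; assumption.
           ++ rewrite blocks_double_succ, even_double_false,
                blocks_double_succ.
              destruct (Nat.even _); lia.
      * rewrite gamma_double_succ, gamma_double_succ_succ.
        apply Hgain with (pred (blocks k)).
        -- apply Cmod_twist_twist_r; assumption.
        -- rewrite blocks_double_succ; destruct (Nat.even _); lia.
  - rewrite even_double_false, blocks_double_succ, gamma_double_succ,
      gamma_double_succ_succ.
    destruct (Nat.eq_dec m 0) as [->|Hm].
    { change (blocks 0) with 0%nat; simpl Nat.even; cbv iota; simpl pow.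
      split; [apply Cmod_twist_le|]; apply Cmod_gamma_le_1. }
    specialize (IH m ltac:(lia)).
    destruct (Nat.even m); rewrite ?Nat.add_1_r, ?Nat.add_0_r in *; simpl pred;
      (split; [apply Cmod_twist_le|]; apply IH).
Qed.

Lemma exp_monotone (x y : R) : x <= y -> exp x <= exp y.
Proof.
  intros [H|H]; [left; apply exp_increasing, H|right; f_equal; exact H].
Qed.

Lemma pow_exp (x : R) (n : nat) : exp x ^ n = exp (INR n * x).
Proof.
  induction n as [|n IH].
  - simpl; rewrite Rmult_0_l, exp_0; reflexivity.
  - rewrite S_INR; simpl pow; rewrite IH, <- exp_plus; f_equal; ring.
Qed.

Lemma Cmod_gamma_le_exp (x : R) (t : nat) :
  - PI <= x <= PI -> (1 <= blocks t)%nat ->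
  Cmod (gamma t x) <= exp (- (INR (blocks t) - 1) * x ^ 2 / 216).
Proof.
  intros Hx Hb.
  (* The contraction factor is at most 1 - x^2/108 with 108 = 6 * 18, and r is the square root of
     exp(- x^2/108). *)
  set (r := exp (- (x ^ 2 / 216))).
  assert (Hr : 0 <= r <= 1).
  { split; [left; apply exp_pos|].
    rewrite <- exp_0; apply exp_monotone; nra. }
  assert (Hr2 : 1 - (1 - cos x) / 6 <= r ^ 2).
  { replace (r ^ 2) with (exp (- (x ^ 2 / 108))).
    - pose proof (exp_ineq1_le (- (x ^ 2 / 108))).
      pose proof (one_minus_cos_ge x Hx); lra.
    - unfold r; rewrite pow_exp; f_equal; simpl; field. }
  destruct (Cmod_gamma_pair_le x r t Hr Hr2) as [H _].
  apply Rle_trans with (1 := H).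
  apply Rle_trans with (r ^ pred (blocks t)).
  { apply pow_le_of_le_1; [exact Hr|]; destruct (Nat.even t); lia. }
  right; unfold r; rewrite pow_exp; f_equal.
  rewrite <- Nat.sub_1_r, minus_INR by exact Hb; simpl; field.
Qed.

(** * Comparison with the Gaussian *)

(** Above, exp y <= 1 / (1 - y), and (1 - y)(1 + y + 2y^2) = 1 + y^2 (1 - 2y) >= 1. *)
Lemma exp_quadratic_bounds (y : R) : Rabs y <= / 2 ->
  1 + y <= exp y <= 1 + y + 2 * y ^ 2.
Proof.
  intros Hy; apply Rabs_le_between in Hy.
  split; [apply exp_ineq1_le|].
  pose proof (exp_ineq1_le (- y)) as H.
  rewrite exp_Ropp in H.
  pose proof (exp_pos y) as Hp.
  assert (H1 : (1 - y) * exp y <= 1).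
  { replace 1 with (/ exp y * exp y) at 2 by (field; lra).
    apply Rmult_le_compat_r; lra. }
  assert (H2 : 1 <= (1 - y) * (1 + y + 2 * y ^ 2)).
  { assert (0 <= y ^ 2 * (1 - 2 * y)) by (apply Rmult_le_pos; nra). nra. }
  nra.
Qed.

Lemma cos_quadratic_bounds (x : R) : Rabs x <= 1 ->
  1 - x ^ 2 / 2 <= cos x <= 1 - x ^ 2 / 2 + x ^ 4 / 24.
Proof.
  intros Hx; apply Rabs_le_between in Hx.
  pose proof (pre_cos_bound x 0 ltac:(lra) ltac:(lra)) as [H1 H2].
  unfold cos_approx, cos_term in *; simpl in *.
  split; nra.
Qed.

Lemma exp_neg_lipschitz (a b q : R) : 0 <= a -> 0 <= b -> 0 <= q ->
  Rabs (exp (- a * q) - exp (- b * q)) <= Rabs (a - b) * q.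
Proof.
  assert (H : forall u v, 0 <= u -> u <= v -> exp (- u) - exp (- v) <= v - u).
  { intros u v Hu Huv.
    replace (- v) with (- u + - (v - u)) by ring; rewrite exp_plus.
    pose proof (exp_ineq1_le (- (v - u))).
    assert (exp (- u) <= 1) by (rewrite <- exp_0; apply exp_monotone; lra).
    pose proof (exp_pos (- u)).
    assert (exp (- (v - u)) <= 1) by (rewrite <- exp_0; apply exp_monotone; lra).
    nra. }
  intros Ha Hb Hq.
  replace (- a * q) with (- (a * q)) by ring.
  replace (- b * q) with (- (b * q)) by ring.
  destruct (Rle_dec a b) as [L|L].
  - pose proof (H (a * q) (b * q) ltac:(nra) ltac:(nra)).
    assert (exp (- (b * q)) <= exp (- (a * q))) by (apply exp_monotone; nra).
    rewrite Rabs_pos_eq, Rabs_minus_sym, Rabs_pos_eq by lra; lra.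
  - pose proof (H (b * q) (a * q) ltac:(nra) ltac:(nra)).
    assert (exp (- (a * q)) <= exp (- (b * q))) by (apply exp_monotone; nra).
    rewrite Rabs_minus_sym, Rabs_pos_eq, Rabs_pos_eq by lra; lra.
Qed.

Definition gauss (k x : R) : R := exp (- k * (x ^ 2 / 2)).

Lemma gauss_pos (k x : R) : 0 < gauss k x.
Proof. apply exp_pos. Qed.

Lemma gauss_le_1 (k x : R) : 0 <= k -> gauss k x <= 1.
Proof.
  intros Hk; unfold gauss; rewrite <- exp_0; apply exp_monotone; nra.
Qed.

(** With q = x^2/2, taking out exp(- m q) leaves cos x cosh(d q) - exp(- q). Both terms are 1 - q +
    O(q^2), and x^4 = 4 q^2. *)
Lemma twist_gauss_re (m d x : R) : 0 <= m -> Rabs d <= 1 -> Rabs x <= 1 ->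
  Rabs (cos x * (gauss (m - d) x + gauss (m + d) x) / 2 - gauss (m + 1) x)
  <= x ^ 4.
Proof.
  intros Hm Hd Hx.
  set (q := x ^ 2 / 2).
  assert (Hq : 0 <= q <= / 2).
  { apply Rabs_le_between in Hx; unfold q; nra. }
  apply Rabs_le_between in Hd.
  replace (cos x * (gauss (m - d) x + gauss (m + d) x) / 2 - gauss (m + 1) x)
    with (exp (- m * q)
          * (cos x * ((exp (d * q) + exp (- d * q)) / 2) - exp (- q))).
  2: { unfold gauss; fold q.
       replace (- (m - d) * q) with (- m * q + d * q) by ring.
       replace (- (m + d) * q) with (- m * q + - d * q) by ring.
       replace (- (m + 1) * q) with (- m * q + - q) by ring.
       rewrite !exp_plus; field. }
  rewrite Rabs_mult, (Rabs_pos_eq (exp _)) by (left; apply exp_pos).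
  assert (E : exp (- m * q) <= 1).
  { rewrite <- exp_0; apply exp_monotone; nra. }
  pose proof (exp_pos (- m * q)) as E0.
  assert (0 <= (1 - d) * q) by (apply Rmult_le_pos; lra).
  assert (0 <= (1 + d) * q) by (apply Rmult_le_pos; lra).
  pose proof (exp_quadratic_bounds (d * q)
    ltac:(apply Rabs_le; lra)) as H1.
  pose proof (exp_quadratic_bounds (- d * q)
    ltac:(apply Rabs_le; lra)) as H2.
  pose proof (exp_quadratic_bounds (- q) ltac:(apply Rabs_le; lra)) as H3.
  pose proof (cos_quadratic_bounds x Hx) as H4.
  pose proof (COS_bound x) as H5.
  replace (x ^ 4) with (4 * q ^ 2) in * by (unfold q; field).
  fold q in H4.
  set (ch := (exp (d * q) + exp (- d * q)) / 2).
  assert (Hch : 1 <= ch <= 1 + 2 * q ^ 2).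
  { unfold ch; assert (d ^ 2 * q ^ 2 <= q ^ 2) by nra.
    split; nra. }
  assert (Hc : 0 <= cos x) by nra.
  assert (B : Rabs (cos x * ch - exp (- q)) <= 4 * q ^ 2).
  { apply Rabs_le; split; nra. }
  pose proof (Rabs_pos (cos x * ch - exp (- q))).
  nra.
Qed.

(** The sine contributes |x| and the difference of the Gaussians x^2. This term limits the
    comparison to third order. *)
Lemma twist_gauss_im (a b x : R) : 0 <= a -> 0 <= b -> Rabs (a - b) <= 2 ->
  Rabs (sin x * (gauss a x - gauss b x) / 2) <= Rabs x ^ 3 / 2.
Proof.
  intros Ha Hb Hab.
  pose proof (exp_neg_lipschitz a b (x ^ 2 / 2) Ha Hb ltac:(nra)) as H.
  fold (gauss a x) in H; fold (gauss b x) in H.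
  unfold Rdiv; rewrite !Rabs_mult, (Rabs_pos_eq (/ 2)) by lra.
  assert (Hs : Rabs (sin x) <= Rabs x).
  { assert (G : forall y, 0 <= y -> Rabs (sin y) <= y).
    { intros y Hy.
      destruct (Rle_dec y 1) as [L|L].
      - pose proof PI_RGT_0; pose proof PI2_1.
        rewrite Rabs_pos_eq.
        + destruct (Req_dec y 0) as [->|Hn]; [rewrite sin_0; lra|].
          left; apply sin_lt_x; lra.
        + apply sin_ge_0; unfold PI2 in *; lra.
      - pose proof (SIN_bound y); apply Rabs_le; lra. }
    destruct (Rle_dec 0 x).
    - rewrite (Rabs_pos_eq x) by assumption; apply G; assumption.
    - rewrite <- (Rabs_Ropp (sin x)), <- sin_neg, (Rabs_left x) by lra.
      apply G; lra. }
  assert (H' : Rabs (gauss a x - gauss b x) <= x ^ 2).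
  { pose proof (pow2_ge_0 x); nra. }
  replace (Rabs x ^ 3) with (Rabs x * x ^ 2) by (rewrite <- (pow2_abs x); ring).
  pose proof (Rabs_pos (sin x)); pose proof (Rabs_pos (gauss a x - gauss b x)).
  apply Rmult_le_compat_r; [lra|].
  apply Rmult_le_compat; assumption.
Qed.

Lemma Cmod_le_sum (z : C) : Cmod z <= Rabs (fst z) + Rabs (snd z).
Proof.
  destruct z as [u v]; simpl.
  replace ((u, v) : C) with (RtoC u + RtoC v * Ci)%C
    by (apply injective_projections; simpl; ring).
  eapply Rle_trans; [apply Cmod_triangle|].
  rewrite Cmod_mult, !Cmod_R, Cmod_Ci; lra.
Qed.

Lemma twist_gauss (a b x : R) : 0 <= a -> 0 <= b -> Rabs (a - b) <= 2 ->
  Cmod (twist x (gauss a x) (gauss b x) - gauss ((a + b) / 2 + 1) x)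
  <= 2 * Rabs x ^ 3.
Proof.
  intros Ha Hb Hab.
  destruct (Rle_dec (Rabs x) 1) as [L|L].
  - eapply Rle_trans; [apply Cmod_le_sum|].
    pose proof (twist_gauss_im a b x Ha Hb Hab) as H1.
    pose proof (twist_gauss_re ((a + b) / 2) ((b - a) / 2) x) as H2.
    replace ((a + b) / 2 - (b - a) / 2) with a in H2 by field.
    replace ((a + b) / 2 + (b - a) / 2) with b in H2 by field.
    specialize (H2 ltac:(lra)).
    apply Rabs_le_between in Hab.
    specialize (H2 ltac:(apply Rabs_le; lra) L).
    match goal with |- Rabs ?u + Rabs ?v <= _ =>
      replace u with (cos x * (gauss a x + gauss b x) / 2
                      - gauss ((a + b) / 2 + 1) x);
      [replace v with (sin x * (gauss a x - gauss b x) / 2)|] end.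
    + pose proof (Rabs_pos x).
      replace (x ^ 4) with (Rabs x ^ 3 * Rabs x) in H2
        by (replace (x ^ 4) with ((x ^ 2) ^ 2) by ring;
            rewrite <- (pow2_abs x); ring).
      assert (0 <= Rabs x ^ 3) by (apply pow_le; assumption).
      nra.
    + unfold twist, cis; rewrite cos_neg, sin_neg; simpl; field.
    + unfold twist, cis; rewrite cos_neg, sin_neg; simpl; field.
  (* For |x| > 1 the trivial bound 2 on the modulus suffices. *)
  - apply Rle_trans with 2.
    + unfold Cminus; eapply Rle_trans; [apply Cmod_triangle|].
      rewrite Cmod_opp, Cmod_R, (Rabs_pos_eq (gauss _ x))
        by (left; apply gauss_pos).
      pose proof (gauss_le_1 ((a + b) / 2 + 1) x ltac:(lra)).
      assert (G : forall k, 0 <= k -> Cmod (gauss k x) <= 1).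
      { intros k Hk; rewrite Cmod_R, Rabs_pos_eq by (left; apply gauss_pos).
        apply gauss_le_1, Hk. }
      pose proof (Cmod_twist_le x 1 (gauss a x) (gauss b x) (G a Ha) (G b Hb)).
      lra.
    + assert (1 <= Rabs x ^ 3) by (apply pow_R1_Rle; lra). lra.
Qed.

Lemma twist_minus (x : R) (u v u' v' : C) :
  (twist x u v - twist x u' v' = twist x (u - u') (v - v'))%C.
Proof. unfold twist; ring. Qed.

Lemma gamma_double_succ_gauss (t : nat) (x : R) :
  Cmod (gamma (2 * t + 1) x - gauss (kappa2 (2 * t + 1)) x)
  <= (Cmod (gamma t x - gauss (kappa2 t) x)
      + Cmod (gamma (t + 1) x - gauss (kappa2 (t + 1)) x)) / 2
     + 2 * Rabs x ^ 3.
Proof.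
  rewrite gamma_double_succ, kappa2_double_succ.
  set (a := kappa2 t); set (b := kappa2 (t + 1)).
  replace (twist x (gamma t x) (gamma (t + 1) x) - gauss ((a + b) / 2 + 1) x)%C
    with (twist x (gamma t x - gauss a x) (gamma (t + 1) x - gauss b x)
          + (twist x (gauss a x) (gauss b x)
             - gauss ((a + b) / 2 + 1) x))%C
    by (rewrite <- twist_minus; ring).
  eapply Rle_trans; [apply Cmod_triangle|].
  apply Rplus_le_compat; [apply Cmod_twist|].
  apply twist_gauss; try apply kappa2_nonneg.
  rewrite Rabs_minus_sym; apply kappa2_step.
Qed.

(* The error obeys the same recursion as [kappa2], up to the factor
   [2 * Rabs x ^ 3]. *)
Lemma gamma_gauss_pair (x : R) (t : nat) :
  Cmod (gamma t x - gauss (kappa2 t) x) <= 2 * Rabs x ^ 3 * kappa2 t /\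
  Cmod (gamma (t + 1) x - gauss (kappa2 (t + 1)) x)
  <= 2 * Rabs x ^ 3 * kappa2 (t + 1).
Proof.
  induction t as [|t IH|t IH] using binary_pair_ind.
  - assert (H0 : Cmod (gamma 0 x - gauss (kappa2 0) x) = 0).
    { unfold gauss; rewrite kappa2_0, gamma_0, Ropp_0, Rmult_0_l, exp_0.
      replace (1 - 1)%C with (RtoC 0) by ring; apply Cmod_0. }
    pose proof (gamma_double_succ_gauss 0 x) as H1.
    change (2 * 0 + 1)%nat with (0 + 1)%nat in H1.
    change (kappa2 (0 + 1)) with 2 in *.
    rewrite kappa2_0 in *; rewrite H0 in *; split; lra.
  - rewrite gamma_double, kappa2_double.
    pose proof (gamma_double_succ_gauss t x) as H.
    rewrite kappa2_double_succ in *; split; [apply IH|lra].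
  - rewrite gamma_double_succ_succ, double_succ_succ, kappa2_double.
    pose proof (gamma_double_succ_gauss t x) as H.
    rewrite kappa2_double_succ in *; split; [lra|apply IH].
Qed.

Lemma gamma_gauss (t : nat) (x : R) :
  Cmod (gamma t x - gauss (kappa2 t) x) <= 2 * Rabs x ^ 3 * kappa2 t.
Proof. apply gamma_gauss_pair. Qed.

(** * Fourier inversion *)

Lemma continuous_cos_scal (k x : R) : continuous (fun y => cos (k * y)) x.
Proof. apply (ex_derive_continuous (V := R_NormedModule)); auto_derive; trivial. Qed.

Lemma continuous_sin_scal (k x : R) : continuous (fun y => sin (k * y)) x.
Proof. apply (ex_derive_continuous (V := R_NormedModule)); auto_derive; trivial. Qed.

Lemma continuous_twist (f g : R -> C) (x : R) :
  continuous (fun y => fst (f y)) x -> continuous (fun y => snd (f y)) x ->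
  continuous (fun y => fst (g y)) x -> continuous (fun y => snd (g y)) x ->
  continuous (fun y => fst (twist y (f y) (g y))) x /\
  continuous (fun y => snd (twist y (f y) (g y))) x.
Proof.
  intros H1 H2 H3 H4.
  assert (Hc : continuous cos x) by apply continuous_cos.
  assert (Hs : continuous sin x) by apply continuous_sin.
  split.
  - apply continuous_ext with (fun y =>
      plus (scal (cos y) (scal (/ 2) (plus (fst (f y)) (fst (g y)))))
           (scal (sin y) (scal (/ 2) (minus (snd (g y)) (snd (f y)))))).
    + intros y; unfold twist, cis; rewrite cos_neg, sin_neg.
      unfold scal, plus, minus, opp; simpl; unfold mult, plus, opp; simpl; ring.
    + apply (continuous_plus (V := R_NormedModule));
      apply (continuous_scal (V := R_NormedModule)); trivial;
      apply (continuous_scal_r (V := R_NormedModule)).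
      * apply (continuous_plus (V := R_NormedModule)); assumption.
      * apply (continuous_minus (V := R_NormedModule)); assumption.
  - apply continuous_ext with (fun y =>
      plus (scal (cos y) (scal (/ 2) (plus (snd (f y)) (snd (g y)))))
           (scal (sin y) (scal (/ 2) (minus (fst (f y)) (fst (g y)))))).
    + intros y; unfold twist, cis; rewrite cos_neg, sin_neg.
      unfold scal, plus, minus, opp; simpl; unfold mult, plus, opp; simpl; ring.
    + apply (continuous_plus (V := R_NormedModule));
      apply (continuous_scal (V := R_NormedModule)); trivial;
      apply (continuous_scal_r (V := R_NormedModule)).
      * apply (continuous_plus (V := R_NormedModule)); assumption.
      * apply (continuous_minus (V := R_NormedModule)); assumption.
Qed.

Lemma continuous_gamma_pair (x : R) (t : nat) :
  (continuous (fun y => fst (gamma t y)) x /\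
   continuous (fun y => snd (gamma t y)) x) /\
  (continuous (fun y => fst (gamma (t + 1) y)) x /\
   continuous (fun y => snd (gamma (t + 1) y)) x).
Proof.
  assert (Hstep : forall t,
    (continuous (fun y => fst (gamma t y)) x /\
     continuous (fun y => snd (gamma t y)) x) /\
    (continuous (fun y => fst (gamma (t + 1) y)) x /\
     continuous (fun y => snd (gamma (t + 1) y)) x) ->
    continuous (fun y => fst (gamma (2 * t + 1) y)) x /\
    continuous (fun y => snd (gamma (2 * t + 1) y)) x).
  { intros u [[H1 H2] [H3 H4]].
    destruct (continuous_twist (gamma u) (gamma (u + 1)) x H1 H2 H3 H4)
      as [K1 K2].
    split; [apply continuous_ext with (2 := K1)|apply continuous_ext with (2 := K2)];
      intros y; rewrite gamma_double_succ; reflexivity. }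
  induction t as [|t IH|t IH] using binary_pair_ind.
  - split; [split; apply continuous_const|].
    change (gamma (0 + 1)) with gamma1; unfold gamma1; simpl.
    pose proof (gamma1_denominator_pos x).
    split; apply (ex_derive_continuous (V := R_NormedModule)); auto_derive; lra.
  - split; [|apply Hstep, IH].
    destruct IH as [[H1 H2] _].
    split; [apply continuous_ext with (2 := H1)|apply continuous_ext with (2 := H2)];
      intros y; rewrite gamma_double; reflexivity.
  - split; [apply Hstep, IH|].
    destruct IH as [_ [H1 H2]].
    split; [apply continuous_ext with (2 := H1)|apply continuous_ext with (2 := H2)];
      intros y; rewrite gamma_double_succ_succ; reflexivity.
Qed.

(** The real part of gamma_t(x) e^{-ijx}, which keeps the inversion integral real-valued. *)
Definition fourier_integrand (j : Z) (t : nat) (x : R) : R :=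
  fst (gamma t x) * cos (IZR j * x) + snd (gamma t x) * sin (IZR j * x).

Lemma continuous_fourier_integrand (j : Z) (t : nat) (x : R) :
  continuous (fourier_integrand j t) x.
Proof.
  destruct (continuous_gamma_pair x t) as [[H1 H2] _].
  apply (continuous_plus (V := R_NormedModule));
    apply (continuous_scal (V := R_NormedModule)); trivial.
  - apply continuous_cos_scal.
  - apply continuous_sin_scal.
Qed.

Lemma ex_RInt_fourier_integrand (j : Z) (t : nat) (a b : R) :
  ex_RInt (fourier_integrand j t) a b.
Proof.
  apply (ex_RInt_continuous (V := R_CompleteNormedModule)).
  intros x _; apply continuous_fourier_integrand.
Qed.

Lemma rotate_re_le_Cmod (z : C) (y : R) :
  Rabs (fst z * cos y + snd z * sin y) <= Cmod z.
Proof.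
  replace (fst z * cos y + snd z * sin y) with (Re (z * cis (- y))).
  - eapply Rle_trans; [apply re_le_Cmod|].
    rewrite Cmod_mult, Cmod_cis; lra.
  - unfold cis; rewrite cos_neg, sin_neg; destruct z; simpl; ring.
Qed.

Definition fourier (j : Z) (t : nat) : R :=
  / (2 * PI) * RInt (fourier_integrand j t) (- PI) PI.

Lemma fourier_integrand_double_succ (j : Z) (t : nat) (x : R) :
  fourier_integrand j (2 * t + 1) x
  = / 2 * (fourier_integrand (j - 1) t x + fourier_integrand (j + 1) (t + 1) x).
Proof.
  unfold fourier_integrand; rewrite gamma_double_succ.
  rewrite minus_IZR, plus_IZR, Rmult_minus_distr_r, Rmult_plus_distr_r, Rmult_1_l.
  rewrite cos_minus, sin_minus, cos_plus, sin_plus.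
  unfold twist, cis; rewrite cos_neg, sin_neg.
  destruct (gamma t x), (gamma (t + 1) x); simpl; ring.
Qed.

Lemma fourier_double (j : Z) (t : nat) : fourier j (2 * t) = fourier j t.
Proof.
  unfold fourier; f_equal; apply RInt_ext; intros x _.
  unfold fourier_integrand; rewrite gamma_double; reflexivity.
Qed.

Lemma fourier_double_succ (j : Z) (t : nat) :
  fourier j (2 * t + 1) = / 2 * (fourier (j - 1) t + fourier (j + 1) (t + 1)).
Proof.
  unfold fourier.
  rewrite (is_RInt_unique _ _ _
    (scal (/ 2) (plus (RInt (fourier_integrand (j - 1) t) (- PI) PI)
                      (RInt (fourier_integrand (j + 1) (t + 1)) (- PI) PI)))).
  - unfold scal, plus; simpl; unfold mult; simpl; ring.
  - apply is_RInt_ext with (fun x =>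
      scal (/ 2) (plus (fourier_integrand (j - 1) t x)
                       (fourier_integrand (j + 1) (t + 1) x))).
    + intros x _; symmetry; apply fourier_integrand_double_succ.
    + apply (is_RInt_scal (V := R_NormedModule)).
      apply (is_RInt_plus (V := R_NormedModule));
        apply (RInt_correct (V := R_CompleteNormedModule));
        apply ex_RInt_fourier_integrand.
Qed.

Lemma fourier_0 (j : Z) : fourier j 0 = if Z.eqb j 0 then 1 else 0.
Proof.
  pose proof PI_RGT_0 as HPI.
  unfold fourier; rewrite (RInt_ext _ (fun x => cos (IZR j * x)))
    by (intros x _; unfold fourier_integrand; rewrite gamma_0; simpl; ring).
  destruct (Z.eqb_spec j 0) as [->|Hj].
  - rewrite (RInt_ext _ (fun x => 1))
      by (intros x _; rewrite Rmult_0_l, cos_0; reflexivity).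
    rewrite RInt_const; unfold scal; simpl; unfold mult; simpl; field; lra.
  - assert (Hj' : IZR j <> 0) by (apply not_0_IZR, Hj).
    assert (Hs : sin (IZR j * PI) = 0) by (apply sin_eq_0_1; exists j; reflexivity).
    rewrite (is_RInt_unique _ _ _ (minus (sin (IZR j * PI) / IZR j)
                                  (sin (IZR j * - PI) / IZR j))).
    + replace (IZR j * - PI) with (- (IZR j * PI)) by ring.
      rewrite sin_neg, Hs; unfold minus, plus, opp; simpl; field; lra.
    + apply (is_RInt_derive (V := R_CompleteNormedModule)
        (fun x => sin (IZR j * x) / IZR j)).
      * intros x _; auto_derive; [trivial|field; exact Hj'].
      * intros x _; apply continuous_cos_scal.
Qed.

Lemma Rabs_fourier_le_1 (j : Z) (t : nat) : Rabs (fourier j t) <= 1.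
Proof.
  pose proof PI_RGT_0 as HPI.
  assert (H : Rabs (RInt (fourier_integrand j t) (- PI) PI) <= (PI - - PI) * 1).
  { apply abs_RInt_le_const; [lra|apply ex_RInt_fourier_integrand|].
    intros x _; eapply Rle_trans; [apply rotate_re_le_Cmod|].
    apply Cmod_gamma_le_1. }
  unfold fourier; rewrite Rabs_mult, Rabs_pos_eq
    by (left; apply Rinv_0_lt_compat; lra).
  apply Rmult_le_reg_l with (2 * PI); [lra|].
  rewrite <- Rmult_assoc, Rinv_r by lra; lra.
Qed.

(** In [count_delta_fourier] the gain 1/2, multiplied by 4t >= 4, pays for the unpaired last term of
    an odd count, whose error is at most 2. *)
Lemma sqrt_double_succ (y : R) : 0 <= y -> sqrt y + / 2 <= sqrt (2 * y + 1).
Proof.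
  intros Hy; pose proof (sqrt_pos y) as H; pose proof (sqrt_sqrt y Hy) as H2.
  rewrite <- (sqrt_Rsqr (sqrt y + / 2)) by lra.
  apply sqrt_le_1_alt; unfold Rsqr; nra.
Qed.

(* Induction on the number of terms rather than on the shift: this handles
   [t = 1], whose recursion refers to itself, like every other shift. *)
Lemma count_delta_fourier (n : nat) : forall (t : nat) (j : Z),
  Rabs (INR (count_delta j t n) - INR n * fourier j t)
  <= 4 * INR t * sqrt (INR n).
Proof.
  induction n as [n IH] using lt_wf_ind; intros t j.
  destruct (Nat.eq_dec n 0) as [->|Hn].
  { unfold count_delta; simpl.
    rewrite Rmult_0_l, Rminus_0_r, Rabs_R0, sqrt_0; lra. }
  destruct (Nat.eq_dec t 0) as [->|Ht].
  { rewrite count_delta_0, fourier_0; destruct Z.eqb; simpl INR;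
      rewrite ?Rmult_1_r, ?Rmult_0_r, ?Rmult_0_l, Rminus_diag, Rabs_R0; lra. }
  assert (Ht1 : 1 <= INR t) by (change 1 with (INR 1); apply le_INR; lia).
  (* The factor t in the bound is preserved exactly: u + u = t for t = 2u, and u + (u + 1) = t for t
     = 2u + 1. Hence [sqrt (INR m)] survives for 2m terms. *)
  assert (Hev : forall m, (m < n)%nat ->
    Rabs (INR (count_delta j t (2 * m)) - INR (2 * m) * fourier j t)
    <= 4 * INR t * sqrt (INR m)).
  { intros m Hm; destruct (Nat.Even_or_Odd t) as [[u ->]|[u ->]].
    - rewrite count_delta_double, fourier_double, !mult_INR; simpl (INR 2).
      replace (2 * _ - 2 * INR m * fourier j u)
        with (2 * (INR (count_delta j u m) - INR m * fourier j u)) by ring.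
      rewrite Rabs_mult, (Rabs_pos_eq 2) by lra.
      pose proof (IH m Hm u j); lra.
    - rewrite count_delta_double_succ, fourier_double_succ, !plus_INR, !mult_INR.
      simpl (INR 2); simpl (INR 1).
      pose proof (IH m Hm u (j - 1)%Z) as H1.
      pose proof (IH m Hm (u + 1)%nat (j + 1)%Z) as H2.
      rewrite plus_INR in H2; simpl (INR 1) in H2.
      match goal with |- Rabs ?e <= _ => replace e with
        ((INR (count_delta (j - 1) u m) - INR m * fourier (j - 1) u)
         + (INR (count_delta (j + 1) (u + 1) m)
            - INR m * fourier (j + 1) (u + 1))) by field end.
      eapply Rle_trans; [apply Rabs_triang|]; lra. }
  destruct (Nat.Even_or_Odd n) as [[m ->]|[m ->]].
  - apply Rle_trans with (1 := Hev m ltac:(lia)).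
    apply Rmult_le_compat_l; [lra|].
    apply sqrt_le_1_alt, le_INR; lia.
  - specialize (Hev m ltac:(lia)).
    rewrite Nat.add_1_r at 1; rewrite count_delta_succ, !plus_INR.
    pose proof (sqrt_double_succ (INR m) (pos_INR m)) as Hsq.
    rewrite mult_INR in *; change (INR 2) with 2 in *; change (INR 1) with 1 in *.
    match goal with |- Rabs (_ + ?e - _) <= _ =>
      assert (Hb : 0 <= e <= 1) by (destruct Z.eqb; simpl; lra); revert Hb;
      generalize e end.
    intros e Hb.
    pose proof (Rabs_fourier_le_1 j t) as Hf.
    apply Rabs_le_between in Hf.
    set (c := INR (count_delta j t (2 * m))) in *.
    replace (c + e - (2 * INR m + 1) * fourier j t)
      with ((c - 2 * INR m * fourier j t) + (e - fourier j t)) by ring.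
    eapply Rle_trans; [apply Rabs_triang|].
    assert (Rabs (e - fourier j t) <= 2) by (apply Rabs_le; lra).
    apply Rle_trans with (4 * INR t * (sqrt (INR m) + / 2)); [lra|].
    apply Rmult_le_compat_l; lra.
Qed.

(** Divided by n, the counting error is 4t / sqrt n, so the limit exists and is squeezed to the
    Fourier coefficient. *)
Lemma delta_fourier (j : Z) (t : nat) : delta j t = fourier j t.
Proof.
  assert (L : is_lim_seq (fun n => 4 * INR t * / sqrt (INR n)) 0).
  { replace (Finite 0) with (Rbar_mult (4 * INR t) 0) by (simpl; f_equal; ring).
    apply is_lim_seq_scal_l.
    replace (Finite 0) with (Rbar_inv p_infty) by reflexivity.
    apply is_lim_seq_inv; [|discriminate].
    apply filterlim_comp with (2 := filterlim_sqrt_p), is_lim_seq_INR. }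
  unfold delta.
  rewrite (is_lim_seq_unique _ (fourier j t)); [reflexivity|].
  apply is_lim_seq_le_le_loc with
    (fun n => fourier j t - 4 * INR t * / sqrt (INR n))
    (fun n => fourier j t + 4 * INR t * / sqrt (INR n)).
  - exists 1%nat; intros n Hn.
    assert (Hn1 : 0 < INR n) by (apply lt_0_INR; lia).
    pose proof (count_delta_fourier n t j) as H.
    pose proof (sqrt_lt_R0 _ Hn1) as Hs.
    pose proof (sqrt_sqrt (INR n) ltac:(lra)) as Hss.
    apply Rabs_le_between in H.
    set (q := sqrt (INR n)) in *; rewrite <- Hss in *.
    set (c := INR (count_delta j t n)) in *.
    split.
    + apply Rmult_le_reg_r with (q * q); [nra|].
      replace (c / (q * q) * (q * q)) with c by (field; lra).
      replace ((fourier j t - 4 * INR t * / q) * (q * q))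
        with (q * q * fourier j t - 4 * INR t * q) by (field; lra).
      lra.
    + apply Rmult_le_reg_r with (q * q); [nra|].
      replace (c / (q * q) * (q * q)) with c by (field; lra).
      replace ((fourier j t + 4 * INR t * / q) * (q * q))
        with (q * q * fourier j t + 4 * INR t * q) by (field; lra).
      lra.
  - replace (Finite (fourier j t)) with (Finite (fourier j t - 0))
      by (f_equal; ring).
    apply is_lim_seq_minus'; [apply is_lim_seq_const|exact L].
  - replace (Finite (fourier j t)) with (Finite (fourier j t + 0))
      by (f_equal; ring).
    apply is_lim_seq_plus'; [apply is_lim_seq_const|exact L].
Qed.

(** * The Fourier transform of a truncated Gaussian *)

Lemma nondecreasing_of_derive (f df : R -> R) (a b : R) : a <= b ->
  (forall x, a <= x <= b -> is_derive f x (df x)) ->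
  (forall x, a <= x <= b -> 0 <= df x) -> f a <= f b.
Proof.
  intros Hab Hd Hp.
  destruct (MVT_gen f a b df) as [c [Hc He]].
  - rewrite Rmin_left, Rmax_right by exact Hab.
    intros x Hx; apply Hd; lra.
  - rewrite Rmin_left, Rmax_right by exact Hab.
    intros x Hx; apply continuity_pt_filterlim.
    apply (ex_derive_continuous (V := R_NormedModule)).
    exists (df x); apply Hd, Hx.
  - rewrite Rmin_left, Rmax_right in Hc by exact Hab.
    specialize (Hp c Hc); nra.
Qed.

Lemma continuous_gauss (k x : R) : continuous (gauss k) x.
Proof.
  apply (ex_derive_continuous (V := R_NormedModule)).
  unfold gauss; auto_derive; trivial.
Qed.

Lemma ex_RInt_gauss (k a b : R) : ex_RInt (gauss k) a b.
Proof.
  apply (ex_RInt_continuous (V := R_CompleteNormedModule)).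
  intros x _; apply continuous_gauss.
Qed.

Lemma is_derive_RInt_gauss_sym (a : R) :
  is_derive (fun u => RInt (gauss 1) (- u) u) a (2 * gauss 1 a).
Proof.
  assert (HP : forall x, is_derive (fun y => RInt (gauss 1) 0 y) x (gauss 1 x)).
  { intros x; apply (is_derive_RInt (V := R_CompleteNormedModule)
      (gauss 1) (fun y => RInt (gauss 1) 0 y) 0 x).
    - exists (mkposreal 1 Rlt_0_1); intros y _.
      apply (RInt_correct (V := R_CompleteNormedModule)), ex_RInt_gauss.
    - apply continuous_gauss. }
  apply is_derive_ext with
    (fun u => minus (RInt (gauss 1) 0 u) (RInt (gauss 1) 0 (- u))).
  { intros u.
    pose proof (RInt_Chasles (V := R_CompleteNormedModule) (gauss 1) 0 (- u) u
      (ex_RInt_gauss 1 _ _) (ex_RInt_gauss 1 _ _)) as H.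
    rewrite <- H; unfold minus, plus, opp; simpl; ring. }
  replace (2 * gauss 1 a) with (minus (gauss 1 a) (scal (-1) (gauss 1 (- a)))).
  - apply (is_derive_minus (V := R_NormedModule)); [apply HP|].
    apply (is_derive_comp (V := R_NormedModule)
      (fun y => RInt (gauss 1) 0 y) (fun u => - u)).
    + apply HP.
    + auto_derive; [trivial|ring].
  - unfold gauss; replace ((- a) ^ 2) with (a ^ 2) by ring.
    unfold minus, plus, opp, scal; simpl; unfold mult; simpl; ring.
Qed.

(** Polar coordinates with x = tan(theta): the integral over [-1, 1] is the mass of exp(-(u^2 +
    v^2)/2) outside the square [-a, a]^2 in one of the four sectors cut by the diagonals. *)
Definition gauss_angular (a x : R) : R :=
  exp (- (a ^ 2 * (1 + x ^ 2) / 2)) / (1 + x ^ 2).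

Lemma is_derive_gauss_angular (a x : R) :
  is_derive (fun u => gauss_angular u x) a
    (- a * exp (- (a ^ 2 * (1 + x ^ 2) / 2))).
Proof.
  assert (0 < 1 + x ^ 2) by nra.
  unfold gauss_angular; auto_derive; [simpl; lra|].
  match goal with |- context [exp ?u] =>
    replace u with (- (a ^ 2 * (1 + x ^ 2) / 2)) by (simpl; field) end.
  simpl; field; simpl in *; lra.
Qed.

Lemma continuous_gauss_angular (a x : R) : continuous (gauss_angular a) x.
Proof.
  assert (0 < 1 + x ^ 2) by nra.
  apply (ex_derive_continuous (V := R_NormedModule)).
  unfold gauss_angular; auto_derive; simpl in *; lra.
Qed.

Lemma continuity_2d_pt_pow (f : R -> R -> R) (x y : R) (n : nat) :
  continuity_2d_pt f x y -> continuity_2d_pt (fun u v => f u v ^ n) x y.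
Proof.
  intros H; induction n as [|n IH]; simpl.
  - apply continuity_2d_pt_const.
  - apply continuity_2d_pt_mult; assumption.
Qed.

Lemma RInt_gauss_scaled (a : R) :
  RInt (fun x => a * gauss 1 (a * x)) (-1) 1 = RInt (gauss 1) (- a) a.
Proof.
  pose proof (RInt_comp_lin (V := R_CompleteNormedModule) (gauss 1) a 0 (-1) 1)
    as H.
  replace (a * -1 + 0) with (- a) in H by ring.
  replace (a * 1 + 0) with a in H by ring.
  rewrite <- H by apply ex_RInt_gauss.
  apply RInt_ext; intros x _; rewrite Rplus_0_r; reflexivity.
Qed.

(** Differentiating in a cancels the denominator 1 + x^2; the exponential then factors, and the
    substitution of ax for x restores the truncated Gaussian integral. *)
Lemma is_derive_RInt_gauss_angular (a : R) :
  is_derive (fun u => RInt (gauss_angular u) (-1) 1) a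
    (- gauss 1 a * RInt (gauss 1) (- a) a).
Proof.
  replace (- gauss 1 a * RInt (gauss 1) (- a) a)
    with (RInt (fun x => Derive (fun u => gauss_angular u x) a) (-1) 1).
  - apply (is_derive_RInt_param gauss_angular).
    + exists (mkposreal 1 Rlt_0_1); intros y _ x _.
      eexists; apply is_derive_gauss_angular.
    + intros x _.
      apply continuity_2d_pt_ext with
        (fun u v => - u * exp (- (u ^ 2 * (1 + v ^ 2) * / 2))).
      * intros u v; symmetry; apply is_derive_unique, is_derive_gauss_angular.
      * apply continuity_2d_pt_mult.
        -- apply continuity_2d_pt_opp, continuity_2d_pt_id1.
        -- apply continuity_1d_2d_pt_comp.
           ++ apply derivable_continuous_pt, derivable_pt_exp.
           ++ apply continuity_2d_pt_opp, continuity_2d_pt_mult;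
                [|apply continuity_2d_pt_const].
              apply continuity_2d_pt_mult.
              ** apply continuity_2d_pt_pow, continuity_2d_pt_id1.
              ** apply continuity_2d_pt_plus; [apply continuity_2d_pt_const|].
                 apply continuity_2d_pt_pow, continuity_2d_pt_id2.
    + exists (mkposreal 1 Rlt_0_1); intros y _.
      apply (ex_RInt_continuous (V := R_CompleteNormedModule)).
      intros x _; apply continuous_gauss_angular.
  - rewrite <- RInt_gauss_scaled.
    rewrite (RInt_ext _ (fun x => scal (- gauss 1 a) (a * gauss 1 (a * x)))).
    + apply is_RInt_unique, (is_RInt_scal (V := R_NormedModule)).
      apply (RInt_correct (V := R_CompleteNormedModule)).
      apply (ex_RInt_continuous (V := R_CompleteNormedModule)).
      intros x _; apply (ex_derive_continuous (V := R_NormedModule)).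
      unfold gauss; auto_derive; trivial.
    + intros x _.
      transitivity (- a * exp (- (a ^ 2 * (1 + x ^ 2) / 2)));
        [apply is_derive_unique, is_derive_gauss_angular|].
      unfold gauss, scal; simpl; unfold mult; simpl.
      match goal with |- _ = - exp ?u * (a * exp ?v) =>
        replace (- exp u * (a * exp v)) with (- a * (exp u * exp v)) by ring;
        rewrite <- exp_plus end.
      f_equal; f_equal; field.
Qed.

Lemma is_RInt_inv_1_plus_square :
  is_RInt (fun x : R => / (1 + x ^ 2)) (-1) 1 (PI / 2).
Proof.
  replace (PI / 2) with (minus (atan 1) (atan (-1))).
  - apply (is_RInt_derive (V := R_CompleteNormedModule) atan).
    + intros x _; auto_derive; [trivial|unfold Rsqr; field; nra].
    + intros x _; apply (ex_derive_continuous (V := R_NormedModule)).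
      auto_derive; simpl; nra.
  - replace (-1) with (- (1)) by ring; rewrite atan_opp, atan_1.
    unfold minus, plus, opp; simpl; field.
Qed.

(* The two terms have opposite derivatives in [a]; the constant is the value at
   [a = 0]. *)
Lemma gauss_integral_square (a : R) : 0 <= a ->
  RInt (gauss 1) (- a) a ^ 2 + 4 * RInt (gauss_angular a) (-1) 1 = 2 * PI.
Proof.
  intros Ha.
  set (f := fun u => RInt (gauss 1) (- u) u ^ 2
                     + 4 * RInt (gauss_angular u) (-1) 1).
  assert (Hf : forall u, is_derive f u 0).
  { intros u.
    assert (K : forall (p q : R -> R) dp dq, is_derive p u dp ->
      is_derive q u dq ->
      is_derive (fun u => p u ^ 2 + 4 * q u) u (2 * p u * dp + 4 * dq)).
    { intros p q dp dq H1 H2.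
      auto_derive; [split; [eexists; exact H1|split; [eexists; exact H2|trivial]]|].
      replace (Derive (fun x : R => p x) u) with dp
        by (symmetry; apply is_derive_unique, H1).
      replace (Derive (fun x : R => q x) u) with dq
        by (symmetry; apply is_derive_unique, H2).
      simpl; ring. }
    replace 0 with (2 * RInt (gauss 1) (- u) u * (2 * gauss 1 u)
                    + 4 * (- gauss 1 u * RInt (gauss 1) (- u) u)) by ring.
    apply (K (fun u => RInt (gauss 1) (- u) u)
             (fun u => RInt (gauss_angular u) (-1) 1)).
    - apply is_derive_RInt_gauss_sym.
    - apply is_derive_RInt_gauss_angular. }
  assert (H0 : f 0 = 2 * PI).
  { unfold f; rewrite Ropp_0, RInt_point.
    rewrite (RInt_ext (gauss_angular 0) (fun x => / (1 + x ^ 2))).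
    2: { intros x _; unfold gauss_angular.
         replace (- (0 ^ 2 * (1 + x ^ 2) / 2)) with 0 by (simpl; field).
         rewrite exp_0; apply Rmult_1_l. }
    rewrite (is_RInt_unique _ _ _ _ is_RInt_inv_1_plus_square).
    unfold zero; simpl; field. }
  change (f a = 2 * PI); rewrite <- H0.
  destruct Ha as [Ha|<-]; [|reflexivity].
  symmetry; apply (eq_is_derive f 0 a); [|exact Ha].
  intros u _; apply Hf.
Qed.

(** With w = sqrt(2 PI), F the integral and G the angular one, w (w - F) <= w^2 - F^2 = 4G, and 1 +
    x^2 >= 1 in the exponent gives 4G <= w^2 [gauss 1 a]. *)
Lemma gauss_integral (a : R) : 0 <= a ->
  Rabs (RInt (gauss 1) (- a) a - sqrt (2 * PI)) <= sqrt (2 * PI) * gauss 1 a.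
Proof.
  intros Ha; pose proof PI_RGT_0 as HPI.
  pose proof (gauss_integral_square a Ha) as H.
  set (F := RInt (gauss 1) (- a) a) in *.
  set (G := RInt (gauss_angular a) (-1) 1) in *.
  assert (HF : 0 <= F).
  { apply RInt_ge_0; [lra|apply ex_RInt_gauss|].
    intros x _; left; apply gauss_pos. }
  assert (Hex : ex_RInt (gauss_angular a) (-1) 1).
  { apply (ex_RInt_continuous (V := R_CompleteNormedModule)).
    intros x _; apply continuous_gauss_angular. }
  assert (HG0 : 0 <= G).
  { apply RInt_ge_0; [lra|exact Hex|].
    intros x _; unfold gauss_angular; apply Rlt_le, Rdiv_lt_0_compat;
      [apply exp_pos|nra]. }
  assert (HG1 : G <= gauss 1 a * (PI / 2)).
  { assert (HI : is_RInt (fun x => scal (gauss 1 a) (/ (1 + x ^ 2))) (-1) 1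
                   (scal (gauss 1 a) (PI / 2))).
    { apply (is_RInt_scal (V := R_NormedModule)), is_RInt_inv_1_plus_square. }
    replace (gauss 1 a * (PI / 2))
      with (RInt (fun x => scal (gauss 1 a) (/ (1 + x ^ 2))) (-1) 1).
    - apply RInt_le; [lra|exact Hex|eexists; exact HI|].
      intros x _; unfold gauss_angular, gauss, scal; simpl; unfold mult; simpl.
      apply Rmult_le_compat_r.
      + left; apply Rinv_0_lt_compat; nra.
      + apply exp_monotone; nra.
    - apply is_RInt_unique, HI. }
  pose proof (sqrt_sqrt (2 * PI) ltac:(lra)) as Hs.
  pose proof (sqrt_lt_R0 (2 * PI) ltac:(lra)) as Hp.
  set (w := sqrt (2 * PI)) in *.
  assert (HFw : F <= w) by nra.
  rewrite Rabs_left1 by lra.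
  assert (w * (w - F) <= w * (w * gauss 1 a)) by nra.
  nra.
Qed.

(** Integration by parts, using that - x [gauss 1 x] is the derivative of [gauss 1]; the sine term
    is the boundary contribution of the truncation. *)
Lemma is_derive_gauss_fourier (a y : R) :
  is_derive (fun z => RInt (fun x => gauss 1 x * cos (x * z)) (- a) a) y
    (2 * gauss 1 a * sin (a * y)
     - y * RInt (fun x => gauss 1 x * cos (x * y)) (- a) a).
Proof.
  assert (Hd : forall x z, is_derive (fun u => gauss 1 x * cos (x * u)) z
                 (- (x * gauss 1 x * sin (x * z)))).
  { intros x z; auto_derive; [trivial|ring]. }
  assert (Hex : forall z, ex_RInt (fun x => gauss 1 x * cos (x * z)) (- a) a).
  { intros z; apply (ex_RInt_continuous (V := R_CompleteNormedModule)).
    intros x _; apply (ex_derive_continuous (V := R_NormedModule)).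
    unfold gauss; auto_derive; trivial. }
  match goal with |- is_derive _ _ ?v => replace v with
    (RInt (fun x => Derive (fun u => gauss 1 x * cos (x * u)) y) (- a) a) end.
  - apply (is_derive_RInt_param (fun z x => gauss 1 x * cos (x * z))).
    + exists (mkposreal 1 Rlt_0_1); intros z _ x _; eexists; apply Hd.
    + intros x _; apply continuity_2d_pt_ext with
        (fun u v => - (v * gauss 1 v * sin (v * u))).
      * intros u v; symmetry; apply is_derive_unique, Hd.
      * apply continuity_2d_pt_opp, continuity_2d_pt_mult.
        -- apply continuity_2d_pt_mult; [apply continuity_2d_pt_id2|].
           apply (continuity_1d_2d_pt_comp (gauss 1) (fun _ v => v)).
           ++ apply continuity_pt_filterlim, continuous_gauss.
           ++ apply continuity_2d_pt_id2.
        -- apply continuity_1d_2d_pt_comp.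
           ++ apply derivable_continuous_pt, derivable_pt_sin.
           ++ apply continuity_2d_pt_mult;
                [apply continuity_2d_pt_id2|apply continuity_2d_pt_id1].
    + exists (mkposreal 1 Rlt_0_1); intros z _; apply Hex.
  - apply is_RInt_unique.
    apply is_RInt_ext with (fun x =>
      minus (- (x * gauss 1 x * sin (x * y)) + y * (gauss 1 x * cos (x * y)))
            (scal y (gauss 1 x * cos (x * y)))).
    { intros x _; transitivity (- (x * gauss 1 x * sin (x * y)));
        [|symmetry; apply is_derive_unique, Hd].
      unfold minus, plus, opp, scal; simpl; unfold mult; simpl; ring. }
    replace (2 * gauss 1 a * sin (a * y)
             - y * RInt (fun x => gauss 1 x * cos (x * y)) (- a) a)
      with (minus (minus (gauss 1 a * sin (a * y)) (gauss 1 (- a) * sin (- a * y)))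
                  (scal y (RInt (fun x => gauss 1 x * cos (x * y)) (- a) a))).
    + apply (is_RInt_minus (V := R_NormedModule)).
      * apply (is_RInt_derive (V := R_CompleteNormedModule)
          (fun x => gauss 1 x * sin (x * y))).
        -- intros x _; unfold gauss; auto_derive; [trivial|].
           match goal with |- context [exp ?u] =>
             replace u with (- (1) * (x ^ 2 / 2)) by (simpl; field) end.
           simpl; field.
        -- intros x _; apply (ex_derive_continuous (V := R_NormedModule)).
           unfold gauss; auto_derive; trivial.
      * apply (is_RInt_scal (V := R_NormedModule)).
        apply (RInt_correct (V := R_CompleteNormedModule)), Hex.
    + replace (- a * y) with (- (a * y)) by ring; rewrite sin_neg.
      unfold gauss; replace ((- a) ^ 2) with (a ^ 2) by ring.
      unfold minus, plus, opp, scal; simpl; unfold mult; simpl; ring.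
Qed.

(* [f] stands for the truncated integral, which satisfies the differential
   equation [f' = - y f] of the Gaussian up to a bounded error [c * h]; the
   weight [2 y / (1 + y)] is a bounded function [w] with [w' + y w >= 1]. *)
Lemma gaussian_ode_perturbation (f h : R -> R) (c y : R) :
  0 <= y -> 0 <= c -> (forall z, Rabs (h z) <= 1) ->
  (forall z, is_derive f z (c * h z - z * f z)) ->
  Rabs (f y - exp (- (y ^ 2 / 2)) * f 0) <= 2 * c.
Proof.
  intros Hy Hc Hh Hf.
  (* The integrating factor exp(z^2/2) turns the equation into (f exp(z^2/2))' = c h exp(z^2/2). The
     sign e treats the upper and the lower bound at once. *)
  assert (Hcmp : forall e : R, Rabs e = 1 ->
    e * (f y * exp (y ^ 2 / 2) - f 0) <= 2 * c * exp (y ^ 2 / 2)).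
  { intros e He.
    set (G := fun z => c * (2 * z / (1 + z)) * exp (z ^ 2 / 2)
                       - e * (f z * exp (z ^ 2 / 2))).
    set (dG := fun z =>
      c * exp (z ^ 2 / 2) * (2 / (1 + z) ^ 2 + 2 * z ^ 2 / (1 + z) - e * h z)).
    assert (HG : G 0 <= G y).
    { apply (nondecreasing_of_derive G dG 0 y Hy).
      - intros z Hz; unfold G, dG.
        pose proof (Hf z) as Hfz.
        assert (Ez : ex_derive f z) by (eexists; exact Hfz).
        auto_derive; [repeat split; trivial; lra|].
        replace (Derive (fun x : R => f x) z) with (c * h z - z * f z)
          by (symmetry; apply is_derive_unique, Hfz).
        match goal with |- context [exp ?u] =>
          replace u with (z ^ 2 / 2) by (simpl; field) end.
        simpl; field; lra.
      - intros z Hz; unfold dG.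
        apply Rmult_le_pos; [apply Rmult_le_pos; [lra|left; apply exp_pos]|].
        assert (He' : e * h z <= 1).
        { apply Rle_trans with (1 := Rle_abs _).
          rewrite Rabs_mult, He, Rmult_1_l; apply Hh. }
        assert (1 <= 2 / (1 + z) ^ 2 + 2 * z ^ 2 / (1 + z)); [|lra].
        apply Rmult_le_reg_r with ((1 + z) ^ 2); [nra|].
        replace ((2 / (1 + z) ^ 2 + 2 * z ^ 2 / (1 + z)) * (1 + z) ^ 2)
          with (2 + 2 * z ^ 2 * (1 + z)) by (field; lra).
        assert (0 <= z ^ 3) by (apply pow_le; lra).
        nra. }
    unfold G in HG.
    replace (0 ^ 2 / 2) with 0 in HG by (simpl; field).
    rewrite exp_0 in HG.
    assert (2 * y / (1 + y) <= 2).
    { apply Rmult_le_reg_r with (1 + y); [lra|].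
      replace (2 * y / (1 + y) * (1 + y)) with (2 * y) by (field; lra); lra. }
    pose proof (exp_pos (y ^ 2 / 2)) as He0.
    assert (c * (2 * y / (1 + y)) * exp (y ^ 2 / 2) <= 2 * c * exp (y ^ 2 / 2)).
    { apply Rmult_le_compat_r; [lra|nra]. }
    lra. }
  pose proof (Hcmp 1 ltac:(apply Rabs_R1)) as H1.
  pose proof (Hcmp (-1) ltac:(rewrite Rabs_left; lra)) as H2.
  rewrite exp_Ropp.
  pose proof (exp_pos (y ^ 2 / 2)) as He.
  set (E := exp (y ^ 2 / 2)) in *.
  apply Rabs_le; split; apply Rmult_le_reg_r with E; try exact He;
    replace ((f y - / E * f 0) * E) with (f y * E - f 0) by (field; lra); lra.
Qed.

(** The constant is 7 = 4 + 3: the perturbation bound with c = 2 [gauss 1 a], and the error of the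
    value at y = 0 with sqrt(2 PI) <= 3. *)
Lemma gauss_fourier_1 (a y : R) : 0 <= a ->
  Rabs (RInt (fun x => gauss 1 x * cos (x * y)) (- a) a
        - sqrt (2 * PI) * exp (- (y ^ 2 / 2))) <= 7 * gauss 1 a.
Proof.
  intros Ha.
  assert (Hpos : forall y, 0 <= y ->
    Rabs (RInt (fun x => gauss 1 x * cos (x * y)) (- a) a
          - sqrt (2 * PI) * exp (- (y ^ 2 / 2))) <= 7 * gauss 1 a).
  { clear y; intros y Hy.
    pose proof (gauss_pos 1 a) as Hg.
    pose proof (gaussian_ode_perturbation
      (fun z => RInt (fun x => gauss 1 x * cos (x * z)) (- a) a)
      (fun z => sin (a * z)) (2 * gauss 1 a) y Hy ltac:(lra)) as H.
    specialize (H ltac:(intros z; apply Rabs_le, SIN_bound)).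
    specialize (H (is_derive_gauss_fourier a)); cbv beta in H.
    rewrite (RInt_ext (fun x => gauss 1 x * cos (x * 0)) (gauss 1)) in H
      by (intros x _; rewrite Rmult_0_r, cos_0; apply Rmult_1_r).
    pose proof (gauss_integral a Ha) as H2.
    assert (Hw : sqrt (2 * PI) <= 3).
    { pose proof PI_4; rewrite <- (sqrt_Rsqr 3) by lra.
      apply sqrt_le_1_alt; unfold Rsqr; lra. }
    assert (He : 0 < exp (- (y ^ 2 / 2)) <= 1).
    { split; [apply exp_pos|].
      rewrite <- exp_0; apply exp_monotone; nra. }
    set (e := exp (- (y ^ 2 / 2))) in *.
    set (I := RInt (fun x => gauss 1 x * cos (x * y)) (- a) a) in *.
    set (F := RInt (gauss 1) (- a) a) in *.
    replace (I - sqrt (2 * PI) * e)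
      with ((I - e * F) + e * (F - sqrt (2 * PI))) by ring.
    eapply Rle_trans; [apply Rabs_triang|].
    rewrite Rabs_mult, (Rabs_pos_eq e) by lra.
    pose proof (Rabs_pos (F - sqrt (2 * PI))).
    assert (sqrt (2 * PI) * gauss 1 a <= 3 * gauss 1 a) by nra.
    nra. }
  destruct (Rle_dec 0 y) as [Hy|Hy]; [apply Hpos, Hy|].
  specialize (Hpos (- y) ltac:(lra)).
  replace ((- y) ^ 2) with (y ^ 2) in Hpos by ring.
  rewrite (RInt_ext _ (fun x => gauss 1 x * cos (x * y))) in Hpos; [exact Hpos|].
  intros x _; rewrite Ropp_mult_distr_r_reverse, cos_neg; reflexivity.
Qed.

(** Rescaling by sqrt k reduces to k = 1 with truncation at sqrt k * PI; the factor 2 comes from 7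
    <= 4 PI. *)
Lemma gauss_fourier (k j : R) : 0 < k ->
  Rabs (/ (2 * PI) * RInt (fun x => gauss k x * cos (j * x)) (- PI) PI
        - / sqrt (2 * PI * k) * exp (- j ^ 2 / (2 * k)))
  <= 2 / sqrt k * gauss k PI.
Proof.
  intros Hk; pose proof PI_RGT_0 as HPI; pose proof PI2_1 as HPI1.
  pose proof (sqrt_lt_R0 k Hk) as Hr.
  pose proof (sqrt_sqrt k ltac:(lra)) as Hrr.
  pose proof (sqrt_lt_R0 (2 * PI) ltac:(lra)) as Hw.
  pose proof (sqrt_sqrt (2 * PI) ltac:(lra)) as Hww.
  rewrite (sqrt_mult (2 * PI) k) by lra.
  set (r := sqrt k) in *; set (w := sqrt (2 * PI)) in *.
  pose proof (gauss_fourier_1 (r * PI) (j / r) ltac:(nra)) as H.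
  fold w in H.
  replace (- ((j / r) ^ 2 / 2)) with (- j ^ 2 / (2 * k)) in H
    by (rewrite <- Hrr; field; lra).
  replace (gauss 1 (r * PI)) with (gauss k PI) in H
    by (unfold gauss; f_equal; rewrite <- Hrr; field).
  replace (RInt (fun x => gauss 1 x * cos (x * (j / r))) (- (r * PI)) (r * PI))
    with (r * RInt (fun x => gauss k x * cos (j * x)) (- PI) PI) in H.
  - set (I := RInt (fun x => gauss k x * cos (j * x)) (- PI) PI) in *.
    set (e := exp (- j ^ 2 / (2 * k))) in *.
    replace (/ (2 * PI) * I - / (w * r) * e)
      with (/ (2 * PI * r) * (r * I - w * e)).
    + rewrite Rabs_mult, Rabs_pos_eq
        by (left; apply Rinv_0_lt_compat; nra).
      pose proof (gauss_pos k PI) as Hg.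
      apply Rle_trans with (/ (2 * PI * r) * (7 * gauss k PI)).
      { apply Rmult_le_compat_l; [left; apply Rinv_0_lt_compat; nra|exact H]. }
      replace (2 / r * gauss k PI)
        with (/ (2 * PI * r) * ((4 * PI) * gauss k PI)) by (field; lra).
      apply Rmult_le_compat_l; [left; apply Rinv_0_lt_compat; nra|].
      unfold PI2 in *; nra.
    + rewrite <- Hww; field; lra.
  - pose proof (RInt_comp_lin (V := R_CompleteNormedModule)
      (fun x => gauss 1 x * cos (x * (j / r))) r 0 (- PI) PI) as HL.
    replace (r * - PI + 0) with (- (r * PI)) in HL by ring.
    replace (r * PI + 0) with (r * PI) in HL by ring.
    rewrite <- HL.
    + symmetry; apply is_RInt_unique.
      apply is_RInt_ext with (fun x => scal r (gauss k x * cos (j * x))).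
      * intros x _; f_equal; rewrite Rplus_0_r; f_equal.
        -- unfold gauss; f_equal; rewrite <- Hrr; field.
        -- f_equal; field; lra.
      * apply (is_RInt_scal (V := R_NormedModule)).
        apply (RInt_correct (V := R_CompleteNormedModule)).
        apply (ex_RInt_continuous (V := R_CompleteNormedModule)).
        intros x _; apply (ex_derive_continuous (V := R_NormedModule)).
        unfold gauss; auto_derive; trivial.
    + apply (ex_RInt_continuous (V := R_CompleteNormedModule)).
      intros x _; apply (ex_derive_continuous (V := R_NormedModule)).
      unfold gauss; auto_derive; trivial.
Qed.

(** * The local limit theorem *)

(** The case P <= T does occur: for small M the cutoff 21 ln M / sqrt M exceeds PI. *)
Lemma abs_RInt_le_split (f : R -> R) (T P A B : R) :
  0 <= T -> 0 <= P -> 0 <= A -> 0 <= B ->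
  (forall a b, ex_RInt f a b) ->
  (forall x, Rabs x <= T -> Rabs (f x) <= A) ->
  (forall x, T <= Rabs x <= P -> Rabs (f x) <= B) ->
  Rabs (RInt f (- P) P) <= 2 * T * A + 2 * P * B.
Proof.
  intros HT HP HA HB Hex H1 H2.
  destruct (Rle_dec P T) as [L|L].
  - assert (H : Rabs (RInt f (- P) P) <= (P - - P) * A).
    { apply abs_RInt_le_const; [lra|apply Hex|].
      intros x Hx; apply H1, Rabs_le; lra. }
    assert (0 <= P * B) by (apply Rmult_le_pos; assumption).
    assert (P * A <= T * A) by (apply Rmult_le_compat_r; assumption).
    lra.
  - assert (E : RInt f (- P) P
                = RInt f (- P) (- T) + (RInt f (- T) T + RInt f T P)).
    { rewrite <- (RInt_Chasles f (- P) (- T) P) by apply Hex.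
      rewrite <- (RInt_Chasles f (- T) T P) by apply Hex.
      reflexivity. }
    assert (B1 : Rabs (RInt f (- P) (- T)) <= (- T - - P) * B).
    { apply abs_RInt_le_const; [lra|apply Hex|].
      intros x Hx; apply H2; rewrite Rabs_left1; lra. }
    assert (B2 : Rabs (RInt f (- T) T) <= (T - - T) * A).
    { apply abs_RInt_le_const; [lra|apply Hex|].
      intros x Hx; apply H1, Rabs_le; lra. }
    assert (B3 : Rabs (RInt f T P) <= (P - T) * B).
    { apply abs_RInt_le_const; [lra|apply Hex|].
      intros x Hx; apply H2; rewrite Rabs_pos_eq; lra. }
    rewrite E.
    pose proof (Rabs_triang (RInt f (- P) (- T)) (RInt f (- T) T + RInt f T P)).
    pose proof (Rabs_triang (RInt f (- T) T) (RInt f T P)).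
    assert (0 <= T * B) by (apply Rmult_le_pos; assumption).
    lra.
Qed.

Definition fourier_error (j : Z) (t : nat) (x : R) : R :=
  fourier_integrand j t x - gauss (kappa2 t) x * cos (IZR j * x).

Lemma ex_RInt_gauss_cos (k j a b : R) :
  ex_RInt (fun x => gauss k x * cos (j * x)) a b.
Proof.
  apply (ex_RInt_continuous (V := R_CompleteNormedModule)).
  intros x _; apply (ex_derive_continuous (V := R_NormedModule)).
  unfold gauss; auto_derive; trivial.
Qed.

Lemma Rabs_fourier_error_le_Cmod (j : Z) (t : nat) (x : R) :
  Rabs (fourier_error j t x) <= Cmod (gamma t x - gauss (kappa2 t) x).
Proof.
  apply Rle_trans with
    (2 := rotate_re_le_Cmod (gamma t x - gauss (kappa2 t) x) (IZR j * x)).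
  right; f_equal; unfold fourier_error, fourier_integrand.
  destruct (gamma t x); simpl; ring.
Qed.

Lemma Rabs_fourier_error_le_tail (j : Z) (t : nat) (x : R) :
  (2 <= blocks t)%nat -> Rabs x <= PI ->
  Rabs (fourier_error j t x) <= 2 * exp (- (INR (blocks t) * x ^ 2 / 432)).
Proof.
  intros Hb Hx.
  eapply Rle_trans; [apply Rabs_fourier_error_le_Cmod|].
  unfold Cminus; eapply Rle_trans; [apply Cmod_triangle|].
  rewrite Cmod_opp, Cmod_R, (Rabs_pos_eq (gauss _ _)) by (left; apply gauss_pos).
  apply Rabs_le_between in Hx.
  assert (Hb2 : 2 <= INR (blocks t)) by (apply (le_INR 2), Hb).
  pose proof (Cmod_gamma_le_exp x t Hx ltac:(lia)) as H1.
  pose proof (blocks_le_kappa2 t) as Hk.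
  pose proof (pow2_ge_0 x) as Hx2.
  (* At least two blocks give M - 1 >= M/2, whence 432 = 2 * 216. *)
  assert (H2 : exp (- (INR (blocks t) - 1) * x ^ 2 / 216)
               <= exp (- (INR (blocks t) * x ^ 2 / 432))).
  { apply exp_monotone; nra. }
  assert (H3 : gauss (kappa2 t) x <= exp (- (INR (blocks t) * x ^ 2 / 432))).
  { unfold gauss; apply exp_monotone; nra. }
  lra.
Qed.

Lemma delta_gauss_le_integral (j : Z) (t : nat) (B : R) :
  0 < kappa2 t -> Rabs (RInt (fourier_error j t) (- PI) PI) <= B ->
  Rabs (delta j t
        - / sqrt (2 * PI * kappa2 t) * exp (- (IZR j ^ 2) / (2 * kappa2 t)))
  <= B + 2 / sqrt (kappa2 t) * gauss (kappa2 t) PI.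
Proof.
  intros Hk HB; pose proof PI_RGT_0 as HPI; pose proof PI2_1 as HPI1.
  pose proof (gauss_fourier (kappa2 t) (IZR j) Hk) as H.
  set (I := RInt (fun x => gauss (kappa2 t) x * cos (IZR j * x)) (- PI) PI) in *.
  assert (E : RInt (fourier_error j t) (- PI) PI
              = RInt (fourier_integrand j t) (- PI) PI - I).
  { apply is_RInt_unique, (is_RInt_minus (V := R_NormedModule));
      apply (RInt_correct (V := R_CompleteNormedModule));
      [apply ex_RInt_fourier_integrand|apply ex_RInt_gauss_cos]. }
  rewrite delta_fourier; unfold fourier.
  rewrite E in HB.
  set (D := RInt (fourier_integrand j t) (- PI) PI) in *.
  set (g := / sqrt (2 * PI * kappa2 t) * exp (- IZR j ^ 2 / (2 * kappa2 t))) in *.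
  replace (/ (2 * PI) * D - g)
    with (/ (2 * PI) * (D - I) + (/ (2 * PI) * I - g)) by ring.
  eapply Rle_trans; [apply Rabs_triang|].
  apply Rplus_le_compat; [|exact H].
  rewrite Rabs_mult, Rabs_pos_eq by (left; apply Rinv_0_lt_compat; lra).
  assert (/ (2 * PI) <= 1).
  { rewrite <- Rinv_1; apply Rinv_le_contravar; unfold PI2 in *; lra. }
  pose proof (Rabs_pos (D - I)).
  nra.
Qed.

Lemma INR_ge_3 (n : nat) : (3 <= n)%nat -> 3 <= INR n.
Proof. intros Hn; apply le_INR in Hn; simpl in Hn; lra. Qed.

Lemma ln_ge_1 (n : nat) : (3 <= n)%nat -> 1 <= ln (INR n).
Proof.
  intros Hn; rewrite <- (ln_exp 1).
  apply ln_le; [apply exp_pos|].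
  apply Rle_trans with (1 := exp_le_3), INR_ge_3, Hn.
Qed.

(* [21 ^ 2 >= 432], so that beyond the cutoff [T = 21 ln M / sqrt M] the
   characteristic function is at most [1 / M]. *)
Lemma RInt_fourier_error (j : Z) (t : nat) :
  (3 <= blocks t)%nat ->
  Rabs (RInt (fourier_error j t) (- PI) PI)
  <= (16 * 21 ^ 4 + 16) * (/ INR (blocks t) * ln (INR (blocks t)) ^ 4).
Proof.
  intros Hb; pose proof PI_RGT_0 as HPI; pose proof PI_4 as HPI4.
  pose proof (ln_ge_1 _ Hb) as HL.
  assert (HM : 3 <= INR (blocks t)) by (apply INR_ge_3, Hb).
  pose proof (kappa2_le_blocks t) as Hk.
  pose proof (kappa2_nonneg t) as Hk0.
  pose proof (Rabs_fourier_error_le_tail j t) as Htail.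
  set (M := INR (blocks t)) in *.
  set (L := ln M) in *.
  pose proof (sqrt_lt_R0 M ltac:(lra)) as Hs.
  pose proof (sqrt_sqrt M ltac:(lra)) as Hss.
  set (q := sqrt M) in *.
  set (T := 21 * L / q).
  assert (HT : 0 <= T).
  { unfold T; apply Rmult_le_pos; [lra|left; apply Rinv_0_lt_compat, Hs]. }
  assert (HT2 : M * T ^ 2 = 441 * L ^ 2).
  { unfold T; rewrite <- Hss; field; lra. }
  assert (HiM : 0 < / M) by (apply Rinv_0_lt_compat; lra).
  assert (HL4 : 1 <= L ^ 4) by (apply pow_R1_Rle, HL).
  pose proof (abs_RInt_le_split (fourier_error j t) T PI
    (2 * T ^ 3 * kappa2 t) (2 * / M) HT ltac:(lra)) as H.
  assert (HT3 : 0 <= T ^ 3) by (apply pow_le, HT).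
  specialize (H ltac:(apply Rmult_le_pos; lra) ltac:(lra)).
  eapply Rle_trans; [apply H; clear H|].
  - intros a b; apply (ex_RInt_minus (V := R_NormedModule));
      [apply ex_RInt_fourier_integrand|apply ex_RInt_gauss_cos].
  - intros x Hx; eapply Rle_trans; [apply Rabs_fourier_error_le_Cmod|].
    apply Rle_trans with (1 := gamma_gauss t x).
    apply Rmult_le_compat_r; [exact Hk0|].
    apply Rmult_le_compat_l; [lra|].
    apply pow_incr; split; [apply Rabs_pos|exact Hx].
  - intros x [Hx1 Hx2].
    apply Rle_trans with (1 := Htail x ltac:(lia) Hx2).
    apply Rmult_le_compat_l; [lra|].
    replace (/ M) with (exp (- L))
      by (rewrite exp_Ropp; unfold L; rewrite exp_ln by lra; reflexivity).
    apply exp_monotone.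
    assert (T ^ 2 <= x ^ 2) by (rewrite <- (pow2_abs x); nra).
    assert (M * T ^ 2 <= M * x ^ 2) by nra.
    nra.
  (* The central part is at most 16 M T^4 = 16 * 21^4 L^4 / M; the outer part is 4 PI / M <= 16 /
     M. *)
  - assert (HT4 : 2 * T * (2 * T ^ 3 * kappa2 t)
                  <= 16 * 21 ^ 4 * (/ M * L ^ 4)).
    { apply Rle_trans with (2 * T * (2 * T ^ 3 * (4 * M))).
      - apply Rmult_le_compat_l; [lra|].
        apply Rmult_le_compat_l; lra.
      - right; unfold T; rewrite <- Hss; field; lra. }
    assert (/ M <= / M * L ^ 4) by nra.
    nra.
Qed.

Theorem theorem1p2 :
  exists (M0 : nat) (C : R),
    forall t : nat, (1 <= t)%nat ->
      forall M : nat, M = blocks t -> (M0 < M)%nat ->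
        forall j : Z,
          Rabs (delta j t
                - / sqrt (2 * PI * kappa2 t) * exp (- (IZR j ^ 2) / (2 * kappa2 t)))
          <= C * / INR M * (ln (INR M)) ^ 4.
Proof.
  (* M >= 3 > e makes ln M >= 1, so terms of order 1/M are absorbed. The constant adds 2 to that of
     [RInt_fourier_error], for truncating the Gaussian at PI. *)
  exists 2%nat, (16 * 21 ^ 4 + 18).
  intros t _ M -> HM j.
  pose proof (ln_ge_1 _ HM) as HL.
  assert (HM3 : 3 <= INR (blocks t)) by (apply INR_ge_3, HM).
  pose proof (blocks_le_kappa2 t) as Hk.
  apply Rle_trans with
    (1 := delta_gauss_le_integral j t _ ltac:(lra) (RInt_fourier_error j t HM)).
  assert (HG : 2 / sqrt (kappa2 t) * gauss (kappa2 t) PI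
               <= 2 * / INR (blocks t)).
  { assert (1 <= sqrt (kappa2 t))
      by (rewrite <- sqrt_1; apply sqrt_le_1_alt; lra).
    pose proof PI2_1 as HPI; unfold PI2 in HPI.
    assert (E : gauss (kappa2 t) PI <= / INR (blocks t)).
    { unfold gauss.
      apply Rle_trans with (exp (- kappa2 t)); [apply exp_monotone|].
      { assert (1 <= PI ^ 2 / 2) by nra; nra. }
      rewrite exp_Ropp; apply Rinv_le_contravar; [lra|].
      pose proof (exp_ineq1_le (kappa2 t)); lra. }
    pose proof (gauss_pos (kappa2 t) PI).
    assert (/ sqrt (kappa2 t) <= 1)
      by (rewrite <- Rinv_1; apply Rinv_le_contravar; lra).
    unfold Rdiv; nra. }
  assert (HiM : 0 < / INR (blocks t)) by (apply Rinv_0_lt_compat; lra).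
  assert (HL4 : 1 <= ln (INR (blocks t)) ^ 4) by (apply pow_R1_Rle, HL).
  nra.
Qed.
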